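(* Assume the following about $h$ and $\mathbf u$: (i) $h(\mathbf x,\mathbf u)$ is differentiable in $\mathbf x$ and there are positive constants $L_1,L_2,L_3$ such that $|h(\mathbf x,\mathbf u_1)-h(\mathbf x,\mathbf u_2)|\le L_1\|\mathbf u_1-\mathbf u_2\|$ for all $\mathbf x$, $|h(\mathbf x_1,\mathbf u)-h(\mathbf x_2,\mathbf u)|\le L_2\|\mathbf x_1-\mathbf x_2\|$ for all $\mathbf u$, and $\|\partial_{\mathbf x}h(\mathbf x_1,\mathbf u)-\partial_{\mathbf x}h(\mathbf x_2,\mathbf u)\|\le L_3\|\mathbf x_1-\mathbf x_2\|$ for all $\mathbf u$; (ii) $\mathbf u$ has bounded support: there is a compact box $\Omega=[\underline u_1,\overline u_1]\times\cdots\times[\underline u_l,\overline u_l]\subset\mathbb R^l$ with $\mathbf u\in\Omega$. Let $\mathbf x^*$ be the unique minimizer over $\mathcal X$ of $\mathbf x\mapsto\mathbb E_{\mathbf u\sim\mathbf P^c}[h(\mathbf x,\mathbf u)]$, and let $\mathbf x_s\in\arg\min_{\mathbf x\in\mathcal X}\mathbb E_{\mathbf P\sim\boldsymbol\pi}\big[\mathbb E_{\mathbf u\sim\mathbf P}[h(\mathbf x,\mathbf u)]\big]$, where $\boldsymbol\pi=\boldsymbol\pi(\cdot\mid\mathbf u_1,\dots,\mathbf u_s)$ is the Dirichlet process posterior. Then, as $s\to+\infty$: 1. (Consistency of the value of the objective function) for each $\mathbf x\in\mathcal X$, $\mathbb E_{\mathbf P\sim\boldsymbol\pi}\big[\mathbb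 E_{\mathbf u\sim\mathbf P}[h(\mathbf x,\mathbf u)]\big]\to\mathbb E_{\mathbf u\sim\mathbf P^c}[h(\mathbf x,\mathbf u)]$ almost surely; 2. (Consistency of the optimal solution) $\mathbf x_s\to\mathbf x^*$ almost surely; 3. (Consistency of the optimal value) $\mathbb E_{\mathbf P\sim\boldsymbol\pi}\big[\mathbb E_{\mathbf u\sim\mathbf P}[h(\mathbf x_s,\mathbf u)]\big]\to\mathbb E_{\mathbf u\sim\mathbf P^c}[h(\mathbf x^*,\mathbf u)]$ almost surely.
   Context: $\mathcal X\subset\mathbb R^d$ is compact; $h(\mathbf x,\mathbf u)$ is a real-valued function of a decision vector $\mathbf x\in\mathcal X$ and of $\mathbf u\in\mathbb R^l$; $\|\cdot\|$ is the Euclidean norm and $\partial_{\mathbf x}$ denotes the partial derivative (gradient) with respect to $\mathbf x$. The random vector $\mathbf u$ has (unknown) true distribution $\mathbf P^c$. The data $\mathbf u_1,\mathbf u_2,\dots$ are i.i.d. with distribution $\mathbf P^c$, all defined on one probability space. For $a>0$ and a probability distribution $Q$, a random probability measure $\mathbf P$ is a Dirichlet process $DP(a,Q)$ if for every finite measurable partition $(A_1,\dots,A_k)$ the vector $(\mathbf P(A_1),\dots,\mathbf P(A_k))$ has Dirichlet distribution with parameters $(aQ(A_1),\dots,aQ(A_k))$. The prior on the unknown distribution is $DP(\alpha,\mathbf P^0)$, with concentration parameter $\alpha>0$ and base distribution $\mathbf P^0$, both fixed; $\mathbf P^0$ is supported on the same box $\Omega$ as $\mathbf u$. The posterior given $\mathbf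 u_1,\dots,\mathbf u_s$ is $$\boldsymbol\pi=\boldsymbol\pi(\cdot\mid\mathbf u_1,\dots,\mathbf u_s)=DP\Big(\alpha+s,\ \frac{\alpha\mathbf P^0+\sum_{j=1}^s\delta_{\mathbf u_j}}{\alpha+s}\Big),$$ where $\delta_{\mathbf u_j}$ is the Dirac measure at $\mathbf u_j$. $\mathbb E_{\mathbf P\sim\boldsymbol\pi}$ is the expectation over $\mathbf P$ drawn from this posterior, with the data held fixed. Almost sure convergence is with respect to the law of the data sequence. *)

(* Defs.v *)
From HB Require Import structures.
From mathcomp Require Import all_boot all_order all_algebra finmap.
From mathcomp Require Import all_classical all_reals all_analysis.

Set Implicit Arguments.
Unset Strict Implicit.
Unset Printing Implicit Defensive.

Import Order.TTheory GRing.Theory Num.Theory.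
Import numFieldNormedType.Exports.

Local Open Scope classical_set_scope.
Local Open Scope ring_scope.

(* The library norm on row vectors is the sup norm; it induces the same
   topology, so the library's [compact] and [-->] are the Euclidean ones. *)
Definition enorm (R : realType) (n : nat) (v : 'rV[R]_n) : R :=
  Num.sqrt (\sum_(i < n) v 0 i ^+ 2).

Definition gradient (R : realType) (n : nat) (f : 'rV[R]_n -> R)
    (x : 'rV[R]_n) : 'rV[R]_n :=
  \row_i 'D_(delta_mx 0 i) (f : 'rV[R]_n -> R^o) x.

Definition borel_rV (R : realType) (n : nat) :=
  g_sigma_algebraType (@open 'rV[R]_n).

Definition box (R : realType) (n : nat) (lo hi : 'rV[R]_n) : set 'rV[R]_n :=
  [set u | forall i, lo 0 i <= u 0 i <= hi 0 i].

Definition argmin (R : realType) (T : Type) (X : set T) (f : T -> \bar R) :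
    set T :=
  [set x | X x /\ forall y, X y -> (f x <= f y)%E].

Definition mutually_independent (R : realType) (d d' : measure_display)
    (W : measurableType d) (T : measurableType d') (P : probability W R)
    (I : choiceType) (Z : I -> {RV P >-> T}) : Prop :=
  forall (J : {fset I}) (B : I -> set T), (forall i, measurable (B i)) ->
    P (\bigcap_(i in [set` J]) (Z i @^-1` B i)) =
    (\prod_(i <- J) P (Z i @^-1` B i))%E.

Definition iid (R : realType) (d d' : measure_display)
    (W : measurableType d) (T : measurableType d') (P : probability W R)
    (Z : nat -> {RV P >-> T}) (Q : probability T R) : Prop :=
  mutually_independent Z /\
  forall j B, measurable B -> distribution P (Z j) B = Q B.

Definition Gamma (R : realType) (a : R) : R :=
  Rintegral lebesgue_measure `]0, +oo[ (fun t => t `^ (a - 1) * expR (- t)).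

(* The Gamma distribution with shape [a] and scale 1, degenerate at 0 when
   [a = 0]. *)
Definition gamma_law (R : realType) (a : R) (B : set R) : \bar R :=
  if a == 0 then \d_(0 : R) B
  else (\int[lebesgue_measure]_(t in B `&` `]0%R, +oo[)
          (t `^ (a - 1) * expR (- t) / Gamma a)%:E)%E.

(* Ferguson's definition of the Dirichlet distribution: the law of
   (Z_1, ..., Z_k) / (Z_1 + ... + Z_k) for independent Z_i ~ Gamma(a_i, 1).
   It allows zero parameters, as long as they are not all zero; the
   corresponding coordinates are then almost surely zero. *)
Definition is_dirichlet (R : realType) (k : nat) (a : 'I_k -> R)
    (mu : set (k.-tuple R) -> \bar R) : Prop :=
  exists (d : measure_display) (W : measurableType d) (P : probability W R)
         (Z : 'I_k -> {RV P >-> R}),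
    [/\ mutually_independent Z,
        (forall i B, measurable B -> distribution P (Z i) B = gamma_law (a i) B)
      & forall B : set (k.-tuple R), measurable B ->
          mu B =
          pushforward P (fun w => [tuple Z i w / \sum_(j < k) Z j w | i < k]) B].

(* [pi] is the law of the random probability measure: a probability on the
   space of probability measures on [T], whose sigma-algebra is generated by
   the evaluations [P |-> P A]. *)
Definition is_dirichlet_process (R : realType) (d : measure_display)
    (T : measurableType d) (a : R) (Q : probability T R)
    (pi : probability (pprobability T R) R) : Prop :=
  forall (k : nat) (A : 'I_k -> set T),
    (forall i, measurable (A i)) ->
    trivIset setT A ->
    \bigcup_i A i = setT ->
    is_dirichlet (fun i => a * fine (Q (A i)))
      (pushforward pi
        (fun P : pprobability T R => [tuple fine (P (A i)) | i < k])).

Section dp_posterior_base.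
Context (R : realType) (d : measure_display) (T : measurableType d).
Context (alpha : {posnum R}) (P0 : probability T R) (s : nat) (u : nat -> T).

Definition dp_posterior_base : set T -> \bar R :=
  mscale ((alpha%:num + s%:R)^-1)%:nng
    (measure_add (mscale alpha%:num%:nng P0) (msum (fun j => \d_(u j)) s)).

HB.instance Definition _ := Measure.on dp_posterior_base.

Lemma dp_posterior_baseE A : dp_posterior_base A =
  ((alpha%:num + s%:R)^-1%:E *
   (alpha%:num%:E * P0 A + \sum_(j < s) \d_(u j) A))%E.
Proof.
by rewrite /dp_posterior_base {1}/mscale [X in (_ * X)%E]measure_addE.
Qed.

Lemma dp_posterior_baseT : dp_posterior_base setT = 1%E.
Proof.
rewrite dp_posterior_baseE probability_setT mule1.
under eq_bigr do rewrite diracT.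
by rewrite sumEFin sumr_const card_ord -EFinD -EFinM mulVf.
Qed.

HB.instance Definition _ :=
  Measure_isProbability.Build d T R dp_posterior_base dp_posterior_baseT.

End dp_posterior_base.

Definition objective (R : realType) (n : nat) (d : measure_display)
    (T : measurableType d) (h : 'rV[R]_n -> T -> R) (P : probability T R)
    (x : 'rV[R]_n) : \bar R :=
  (\int[P]_u (h x u)%:E)%E.

Definition bayes_objective (R : realType) (n : nat) (d : measure_display)
    (T : measurableType d) (h : 'rV[R]_n -> T -> R)
    (pi : probability (pprobability T R) R) (x : 'rV[R]_n) : \bar R :=
  (\int[pi]_P objective h P x)%E.

(* Main.v *)
From HB Require Import structures.
Require Import Defs.
From mathcomp Require Import all_boot all_order all_algebra.
From mathcomp Require Import all_classical all_reals all_analysis.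
From mathcomp Require Import measurable_realfun finmap ring lra.

Set Implicit Arguments.
Unset Strict Implicit.
Unset Printing Implicit Defensive.

Import Order.TTheory GRing.Theory Num.Theory.
Import numFieldNormedType.Exports.

Local Open Scope classical_set_scope.
Local Open Scope ring_scope.

(** The posterior is a Dirichlet process, and the mean measure of a Dirichlet
    process is its base distribution. Hence the Bayesian objective is the
    expected cost under the posterior base distribution, that is,
    [(alpha * E_P0 h(x, u) + \sum_(j < s) h(x, u_j)) / (alpha + s)]
    ([bayes_objectiveE]). The weight of the prior vanishes as [s] grows, and the
    strong law of large numbers sends the rest to [E_Pc h(x, u)]: this is the
    consistency of the objective value at a fixed decision
    ([ae_objective_dp_posterior_base_cvg]).

    The objectives are Lipschitz in [x] with a common constant. So almost sure
    convergence along a dense sequence of decisions, for which countably many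
    null sets suffice, gives almost surely convergence at every decision
    ([lipschitz_cvg_dense]). On a compact set, this and the uniqueness of the
    limit minimizer force the minimizers and the minimal values to converge
    ([argmin_consistency]).

    The mean measure ([dirichlet_process_mean]) reduces to a computation with
    two independent Gamma variables: if [S = Z_1 + Z_2], where [Z_i] has shape
    [a_i], then [E (Z_1 / S) = a_1 / (a_1 + a_2)] ([gamma_ratio_mean]). Writing
    [1 / S] as the integral of [exp (- l S)] over [l >= 0] and using
    [(1 + l) E (Z exp (- l Z)) = a E (exp (- l Z))], an integration by parts
    ([gamma_law_size_bias]), one finds [E (Z_i / S) = a_i K] with [K] symmetric
    in the two variables, and the two means add up to 1. Since the cost is
    bounded on the box, which carries all the distributions involved, the
    identity for measures of sets extends to integrals of the cost
    ([integral_mean_measure]).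

    The strong law is proved for bounded observations ([bounded_slln]): the
    variance of the mean of [n] terms is [O(1 / n)], which is summable along
    [n = k ^ 2], and between consecutive squares the mean barely moves. *)

(** * Minimizers of equi-Lipschitz functions on a compact set *)

Section deterministic.
Context {R : realType} {n : nat}.
Local Notation V := 'rV[R]_n.
Implicit Types (X : set V) (F : V -> R) (D : nat -> V).

(** The exceptional null set of the strong law depends on the decision, so
    the law can only be used at countably many decisions simultaneously; this
    sequence enumerates finite [1 / k.+1]-nets of [X], for all [k]. *)
Lemma compact_dense_sequence X : compact X -> X !=set0 ->
  exists D : nat -> V, (forall k, X (D k)) /\
    forall x e, X x -> 0 < e -> exists k, `|x - D k| < e.
Proof.
move=> cX [x0 Xx0].
have net k : exists S : seq V, (forall y, y \in S -> X y) /\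
    forall x, X x -> exists2 y, y \in S & `|x - y| < k.+1%:R^-1.
  have := cX; rewrite compact_cover => /(_ _ X (fun y => ball y k.+1%:R^-1)).
  case=> [y _||S SX cov]; first exact: ball_open.
    by move=> x Xx; exists x => //; apply: ballxx; rewrite invr_gt0.
  exists (finmap.enum_fset S); split=> [y yS|x /cov[y yS]].
    by have /set_mem := SX y yS.
  by rewrite -ball_normE /ball_ /= distrC => xy; exists y.
have [S /all_and2[SX Sd]] := choice net.
(* The index [m] codes a pair: which net, and which point of that net. *)
exists (fun m => let: (k, i) :=
  odflt (0, 0)%N (choice.unpickle m) in nth x0 (S k) i).
split=> [m|x e Xx e0].
  case: (odflt _ _) => k i; have [iS|iS] := ltnP i (size (S k)).
    by apply: SX; exact: mem_nth.
  by rewrite nth_default.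
have [k _ ke] := near_infty_natSinv_lt (PosNum e0).
have [y yS xy] := Sd k x Xx.
exists (choice.pickle (k, index y (S k))); rewrite choice.pickleK/= nth_index//.
by apply: (lt_trans xy); apply: ke => /=.
Qed.

Lemma lipschitz_cvg_dense X D (K : R) (Fs : nat -> V -> R) F :
  0 < K -> (forall k, X (D k)) ->
  (forall x e, X x -> 0 < e -> exists k, `|x - D k| < e) ->
  (forall s x y, X x -> X y -> `|Fs s x - Fs s y| <= K * `|x - y|) ->
  (forall x y, X x -> X y -> `|F x - F y| <= K * `|x - y|) ->
  (forall k, Fs s (D k) @[s --> \oo] --> F (D k)) ->
  forall x, X x -> Fs s x @[s --> \oo] --> F x.
Proof.
move=> K0 XD dD LFs LF cD x Xx; apply/cvgrPdist_lt => e e0.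
have e30 : 0 < e / 3 by rewrite divr_gt0.
have [k xk] := dD x (e / 3 / K) Xx (divr_gt0 e30 K0).
have {}xk : K * `|x - D k| < e / 3 by rewrite mulrC -ltr_pdivlMr.
have /cvgrPdist_lt/(_ _ e30) := cD k; apply: filterS => s /= sk.
have := LFs s x (D k) Xx (XD k); have := LF x (D k) Xx (XD k).
move: xk sk; rewrite !ltr_norml !ler_norml; set t := K * _.
move=> ? /andP[? ?] /andP[? ?] /andP[? ?]; apply/andP; split; lra.
Qed.

(** Away from [xstar] the limit exceeds its minimum by a margin which, by the
    common Lipschitz constant, the approximations inherit locally; compactness
    makes the threshold on [s] uniform. *)
Lemma argmin_consistency X (K : R) (Fs : nat -> V -> R) F
    (xs : nat -> V) xstar :
  0 < K -> compact X ->
  (forall s x y, X x -> X y -> `|Fs s x - Fs s y| <= K * `|x - y|) ->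
  (forall x, X x -> Fs s x @[s --> \oo] --> F x) ->
  X xstar -> (forall x, X x -> x != xstar -> F xstar < F x) ->
  (forall s, X (xs s)) -> (forall s x, X x -> Fs s (xs s) <= Fs s x) ->
  xs s @[s --> \oo] --> xstar /\ Fs s (xs s) @[s --> \oo] --> F xstar.
Proof.
move=> K0 cX LFs cF Xxstar minF Xxs minFs.
have cvgxs : xs s @[s --> \oo] --> xstar.
  apply/cvgrPdist_lt => e e0.
  pose Q (s : nat) (x : V) := X x -> Fs s x <= Fs s xstar -> `|xstar - x| < e.
  suff : \forall s \near \oo, X `<=` Q s.
    by apply: filterS => s Qs; exact: (Qs _ (Xxs s) (Xxs s) (minFs s _ Xxstar)).
  have /compact_near_coveringP := cX; apply => x Xx.
  have [->|xxs] := eqVneq x xstar.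
    near=> x' s => /= _ _; near: x'.
    exact: (@cvgr_dist_lt _ _ _ _ _ id xstar (@cvg_id _ (nbhs xstar)) e e0).
  have gap := minF x Xx xxs.
  pose eta := (F x - F xstar) / 3.
  have eta0 : 0 < eta by rewrite divr_gt0// subr_gt0.
  (* Near [x], and for [s] large, [Fs s] stays above [Fs s xstar]: three errors
     below [eta] each cannot bridge the gap of [3 * eta]. *)
  near=> x' s => /= Xx' le_s; exfalso.
  have xx' : K * `|x - x'| < eta.
    rewrite mulrC -ltr_pdivlMr//; near: x'.
    apply: (@cvgr_dist_lt _ _ _ _ _ id x (@cvg_id _ (nbhs x))).
    exact: divr_gt0.
  have sx : `|F x - Fs s x| < eta.
    by near: s; move: (cF x Xx) => /cvgrPdist_lt; apply.
  have sxs : `|F xstar - Fs s xstar| < eta.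
    by near: s; move: (cF _ Xxstar) => /cvgrPdist_lt; apply.
  have := LFs s x x' Xx Xx'; move: xx' sx sxs.
  rewrite !ltr_norml !ler_norml; set t := K * _.
  by rewrite /eta => ? /andP[? ?] /andP[? ?] /andP[? ?]; lra.
split=> //; apply/cvgrPdist_lt => e e0.
have e20 : 0 < e / 2 by rewrite divr_gt0.
near=> s.
have sx : `|F xstar - Fs s xstar| < e / 2.
  by near: s; move: (cF _ Xxstar) => /cvgrPdist_lt; apply.
have xx' : K * `|xstar - xs s| < e / 2.
  rewrite mulrC -ltr_pdivlMr//; near: s; move: cvgxs => /cvgrPdist_lt; apply.
  exact: divr_gt0.
have := LFs s xstar (xs s) Xxstar (Xxs s); have := minFs s _ Xxstar.
move: xx' sx; rewrite !ltr_norml !ler_norml; set t := K * _.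
by move=> ? /andP[? ?] ? /andP[? ?]; apply/andP; split; lra.
Unshelve. all: by end_near. Qed.

End deterministic.

(** * A strong law of large numbers for bounded observations *)

Section independence.
Local Open Scope ereal_scope.
Context {R : realType} {d d' : measure_display} {W : measurableType d}
  {T : measurableType d'} (P : probability W R).

(** The joint law of [Z i] and [Z j] agrees with the product of their laws on
    rectangles, hence everywhere, and Tonelli splits the integral. *)
Lemma independent_integralM (I : choiceType) (Z : I -> {RV P >-> T}) (i j : I)
    (f g : T -> \bar R) : mutually_independent Z -> i != j ->
  measurable_fun setT f -> measurable_fun setT g ->
  (forall t, 0 <= f t) -> (forall t, 0 <= g t) ->
  \int[P]_w (f (Z i w) * g (Z j w)) =
  (\int[P]_w f (Z i w)) * (\int[P]_w g (Z j w)).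
Proof.
move=> indZ ij mf mg f0 g0.
have mZ : measurable_fun setT (fun w => (Z i w, Z j w))
  by exact: measurable_fun_pair.
pose phi : {mfun W >-> (T * T)%type} := HB.pack (fun w => (Z i w, Z j w))
  (isMeasurableFun.Build _ _ _ _ _ mZ).
have lawE A : measurable A ->
    (distribution P (Z i) \x distribution P (Z j)) A = distribution P phi A.
  apply: product_measure_unique => /= A1 A2 mA1 mA2.
  have mA k : d'.-measurable (if k == i then A1 else A2) by case: ifP.
  have := indZ [fset i; j]%fset _ mA.
  rewrite big_fsetU1/= ?inE// big_seq_fset1 eqxx eq_sym (negbTE ij) => <-.
  rewrite /distribution /pushforward/=; congr (P _).
  apply/seteqP; split=> w /=.
    move=> [Ai Aj] k /=; rewrite !inE => /orP[/eqP->|/eqP->].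
      by rewrite eqxx.
    by rewrite eq_sym (negbTE ij).
  move=> ZA; split.
    by have := ZA i; rewrite /= !inE eqxx; exact.
  by have := ZA j; rewrite /= !inE eqxx orbT eq_sym (negbTE ij); exact.
have mf1 : measurable_fun setT (fun z : T * T => f z.1).
  exact: measurableT_comp.
have mg2 : measurable_fun setT (fun z : T * T => g z.2).
  exact: measurableT_comp.
transitivity (\int[distribution P phi]_z (f z.1 * g z.2)).
  rewrite ge0_integral_distribution//; first exact: emeasurable_funM.
  by move=> z; exact: mule_ge0.
transitivity (\int[distribution P (Z i) \x distribution P (Z j)]_z
  (f z.1 * g z.2)).
  by apply: eq_measure_integral => A mA _; exact: esym (lawE A mA).
rewrite (fubini_tonelli1 (fun z => f z.1 * g z.2))/=; last 2 first.
  exact: emeasurable_funM.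
  by move=> z; exact: mule_ge0.
rewrite /fubini_F/=.
under eq_integral => x _.
  rewrite ge0_integralZl//; first over.
rewrite ge0_integralZr//; last exact: integral_ge0.
by rewrite !ge0_integral_distribution.
Qed.

End independence.

Section from_squares.
Context {R : realType}.

Lemma floor_sqrt n : exists k, (k ^ 2 <= n < k.+1 ^ 2)%N.
Proof.
have ex0 : exists k, (k ^ 2 <= n)%N by exists 0%N.
have bd k : (k ^ 2 <= n)%N -> (k <= n)%N.
  by apply: leq_trans; rewrite -mulnn; case: k => // k; rewrite leq_pmulr.
have [k kn kmax] := ex_maxnP ex0 bd; exists k; rewrite kn ltnNge.
by apply/negP => /kmax; rewrite ltnn.
Qed.

(** Between two consecutive squares a sum of terms bounded by [B] moves by at
    most [2 k B], which is negligible compared with [k ^ 2]. *)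
Lemma cvg_mean_from_squares (u : nat -> R) (m B : R) :
  (forall j, 0 <= u j <= B) -> 0 <= m <= B ->
  (forall e, 0 < e -> \forall k \near \oo,
    `|\sum_(j < k ^ 2) u j - (k ^ 2)%:R * m| <= e * (k ^ 2)%:R) ->
  (\sum_(j < n) u j) / n%:R @[n --> \oo] --> m.
Proof.
move=> uB /andP[m0 mB] sq; apply/cvgrPdist_le => e e0.
have e20 : 0 < e / 2 by rewrite divr_gt0.
have B0 : 0 <= B := le_trans m0 mB.
have [N _ Nsq] := sq _ e20.
(* The jump costs at most [4 * B * k], which is below [e / 2 * k ^ 2] as soon
   as [k >= 8 * B / e]. *)
have [M _ MB] := nbhs_infty_ger (8 * B / e).
exists ((maxn N M).+1 ^ 2)%N => //= n nlarge.
have [k /andP[kn nk]] := floor_sqrt n.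
have kl : (maxn N M < k)%N.
  by rewrite -ltnS -ltn_sqr; apply: leq_ltn_trans nk.
have k0 : (0 < k)%N by apply: leq_ltn_trans kl.
have n0 : (0 < n)%N by apply: leq_trans kn; rewrite expn_gt0 k0.
have Nk : (N <= k)%N by apply: ltnW; apply: leq_ltn_trans kl; exact: leq_maxl.
have Mk : (M <= k)%N by apply: ltnW; apply: leq_ltn_trans kl; exact: leq_maxr.
have := Nsq k Nk; have /= := MB k Mk.
rewrite ler_pdivrMr// => kB.
have nsub : (n - k ^ 2 <= 2 * k)%N
  by rewrite leq_subLR -ltnS (leq_trans nk)// -addn1 sqrnD muln1 addn1 addSn.
have Sn : \sum_(j < n) u j =
    \sum_(j < k ^ 2) u j + \sum_(k ^ 2 <= j < n) u j.
  by rewrite -!(big_mkord xpredT u) -big_cat_nat.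
have tail0 : 0 <= \sum_(k ^ 2 <= j < n) u j.
  by apply: sumr_ge0 => j _; case/andP: (uB j).
have tailB : \sum_(k ^ 2 <= j < n) u j <= (n - k ^ 2)%:R * B.
  rewrite mulr_natl -sumr_const_nat; apply: ler_sum => j _.
  by case/andP: (uB j).
have nE : n%:R = (k ^ 2)%:R + (n - k ^ 2)%:R :> R by rewrite -natrD subnKC.
have : (n - k ^ 2)%:R <= 2 * k%:R :> R by rewrite -natrM ler_nat.
move: tail0 tailB; rewrite Sn.
set t := \sum_(k ^ 2 <= j < n) u j; set s := \sum_(j < k ^ 2) u j.
have r0 : 0 <= (n - k ^ 2)%:R :> R by [].
move: nE r0; set r := (n - k ^ 2)%:R => nE r0 t0 tr r2 sq_k.
have nR0 : 0 < n%:R :> R by rewrite ltr0n.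
rewrite -(ler_pM2r nR0) -[X in _ * X]gtr0_norm// -normrM mulrBl divfK ?gt_eqF//.
have k2E : (k ^ 2)%:R = k%:R * k%:R :> R by rewrite -natrM mulnn.
have kR0 : 0 < k%:R :> R by rewrite ltr0n.
have rB : r * B <= 2 * k%:R * B by rewrite ler_wpM2r.
have rm : r * m <= r * B by rewrite ler_wpM2l.
have rm0 : 0 <= r * m by rewrite mulr_ge0.
have kkB : 8 * B * k%:R <= k%:R * e * k%:R by rewrite ler_wpM2r// ltW.
have re : 0 <= e * r by rewrite mulr_ge0// ltW.
move: sq_k; rewrite nE k2E !ler_norml => /andP[? ?].
by apply/andP; split; nra.
Qed.

End from_squares.

Section ae_summable.
Local Open Scope ereal_scope.
Context {R : realType} {d : measure_display} {W : measurableType d}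
  (P : probability W R).

(** The series of the [g k] has a finite integral, so it is almost surely
    finite, and the terms of a convergent series tend to 0. *)
Lemma ae_cvg0_summable_integral (g : nat -> W -> R) :
  (forall k, measurable_fun setT (g k)) -> (forall k w, (0 <= g k w)%R) ->
  \sum_(0 <= k <oo) \int[P]_w (g k w)%:E < +oo ->
  {ae P, forall w, g k w @[k --> \oo] --> 0%R}.
Proof.
move=> mg g0 sumg.
have mEg k : measurable_fun setT (fun w => (g k w)%:E)
  by exact/measurable_EFinP.
have Eg0 k w : 0 <= (g k w)%:E by rewrite lee_fin.
pose G w := \sum_(0 <= k <oo) (g k w)%:E.
have G0 w : 0 <= G w by apply: nneseries_ge0 => k _ _; exact: Eg0.
have mG : measurable_fun setT G by apply: ge0_emeasurable_sum => // k w _ _;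
  exact: Eg0.
have : P.-integrable setT G.
  apply/integrableP; split=> //.
  under eq_integral do rewrite gee0_abs//.
  by rewrite /G integral_nneseries.
move=> /integrable_ae => /(_ measurableT);
  apply: filterS => w /(_ Logic.I) Gfin.
have := @nneseries_tail_cvg _ (fun k => (g k w)%:E) xpredT.
have Goo : G w < +oo by rewrite -ge0_fin_numE.
move=> /(_ Goo (fun k _ => Eg0 k w)) tail0.
have /fine_cvgP[_] : (fun k => (g k w)%:E) @ \oo --> 0%:E; last exact.
apply: squeeze_cvge (cvg_cst _) tail0.
apply: nearW => k; rewrite Eg0/=.
have := @nneseries_lim_ge _ (fun k => (g k w)%:E) xpredT k k.+1.
by rewrite big_nat1; apply.
Qed.

(** Telescoping: [1 / (k + 1) ^ 2 <= 1 / k - 1 / (k + 1)]. *)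
Lemma sum_invr_sqr_le n : (\sum_(k < n) (k.+1%:R ^+ 2)^-1 <= 2 :> R)%R.
Proof.
case: n => [|n]; first by rewrite big_ord0.
suff : (\sum_(k < n.+1) (k.+1%:R ^+ 2)^-1 <= 2 - n.+1%:R^-1 :> R)%R.
  by move=> /le_trans; apply; rewrite gerBl invr_ge0.
elim: n => [|n IHn]; first by rewrite big_ord1 expr1n invr1; lra.
rewrite big_ord_recr/= (le_trans (lerD IHn (lexx _)))//.
have a0 : (0 < n.+1%:R :> R)%R by [].
have b0 : (0 < n.+2%:R :> R)%R by [].
have ab : (n.+2%:R = n.+1%:R + 1 :> R)%R by rewrite -natr1.
suff : (n.+2%:R ^- 2 <= n.+1%:R^-1 - n.+2%:R^-1 :> R)%R.
  have lin (x y z : R) : (x <= z - y)%R -> (2 - z + x <= 2 - y)%R by lra.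
  exact: lin.
have -> : (n.+1%:R^-1 - n.+2%:R^-1 = (n.+1%:R * n.+2%:R)^-1 :> R)%R.
  have fld (a : R) : (0 < a)%R -> (a^-1 - (a + 1)^-1 = (a * (a + 1))^-1)%R.
    by move=> apos; field; apply/andP; split; apply: lt0r_neq0; lra.
  by rewrite ab fld.
by rewrite lef_pV2 ?posrE ?mulr_gt0 ?exprn_gt0// expr2 ler_wpM2r// ler_nat.
Qed.

End ae_summable.

Section slln.
Local Open Scope ereal_scope.
Context {R : realType} {d d' : measure_display} {W : measurableType d}
  {T : measurableType d'} (P : probability W R).
Variables (U : nat -> {RV P >-> T}) (Q : probability T R).
Hypothesis iidU : iid U Q.
Variables (f : T -> R) (B : R).
Hypothesis mf : measurable_fun setT f.
Hypothesis f0 : forall t, (0 <= f t)%R.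
Hypothesis fB : forall t, (f t <= B)%R.

Let m : R := fine (\int[Q]_t (f t)%:E).
Let S n w : R := (\sum_(j < n) f (U j w))%R.

Let B0 : (0 <= B)%R. Proof. exact: le_trans (f0 point) (fB point). Qed.

Let meanE : m%:E = \int[Q]_t (f t)%:E.
Proof.
rewrite fineK// ge0_fin_numE; last by apply: integral_ge0 => t _;
  rewrite lee_fin.
apply: (@le_lt_trans _ _ (\int[Q]_t B%:E)).
  apply: ge0_le_integral => //.
  - by move=> t _; rewrite lee_fin.
  - exact/measurable_EFinP.
  - by move=> t _; rewrite lee_fin.
by rewrite integral_cst//= probability_setT mule1 ltry.
Qed.

Let m0 : (0 <= m)%R.
Proof. by rewrite -lee_fin meanE; apply: integral_ge0 => t _;
  rewrite lee_fin. Qed.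

Let mB : (m <= B)%R.
Proof.
rewrite -lee_fin meanE (@le_trans _ _ (\int[Q]_t B%:E))//.
  apply: ge0_le_integral => //.
  - by move=> t _; rewrite lee_fin.
  - exact/measurable_EFinP.
  - by move=> t _; rewrite lee_fin.
by rewrite integral_cst//= probability_setT mule1.
Qed.

Let mfU j : measurable_fun setT (fun w => f (U j w)).
Proof. exact: measurableT_comp. Qed.

Let mEfU j : measurable_fun setT (fun w => (f (U j w))%:E).
Proof. exact/measurable_EFinP. Qed.

Let integral_fU j : \int[P]_w (f (U j w))%:E = m%:E.
Proof.
have mEf : measurable_fun setT (fun t => (f t)%:E) by exact/measurable_EFinP.
rewrite meanE.
rewrite -(@ge0_integral_distribution _ _ _ _ _ P (U j) (fun t => (f t)%:E)) //.
  by apply: eq_measure_integral => A mA _; exact: iidU.2.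
Qed.

Let integral_S n : \int[P]_w (S n w)%:E = (n%:R * m)%:E.
Proof.
under eq_integral do rewrite /S -sumEFin.
rewrite ge0_integral_sum//; last by move=> j w _; rewrite lee_fin.
under eq_bigr do rewrite integral_fU.
by rewrite sumEFin sumr_const card_ord mulr_natl.
Qed.

(* Independence gives [m ^ 2] for each off-diagonal term; the diagonal ones are
   at most [B ^ 2]. *)
Let integral_S2 n : \int[P]_w ((S n w) ^+ 2)%:E <=
  (n%:R * (n%:R * m ^+ 2 + B ^+ 2))%:E.
Proof.
have S2E w : ((S n w) ^+ 2)%:E =
    \sum_(i < n) \sum_(j < n) ((f (U i w))%:E * (f (U j w))%:E).
  rewrite expr2 /S mulr_suml -sumEFin; apply: eq_bigr => i _.
  by rewrite mulr_sumr -sumEFin.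
under eq_integral do rewrite S2E.
have ffU0 i j w : 0 <= (f (U i w))%:E * (f (U j w))%:E.
  by rewrite mule_ge0// lee_fin.
have mff i j : measurable_fun setT (fun w => (f (U i w))%:E * (f (U j w))%:E).
  exact: emeasurable_funM.
rewrite ge0_integral_sum//; last 2 first.
- by move=> i; apply: emeasurable_sum => j.
- by move=> i w _; apply: sume_ge0 => j _.
have le_row (i : 'I_n) :
    \int[P]_w (\sum_(j < n) ((f (U i w))%:E * (f (U j w))%:E)) <=
    (n%:R * m ^+ 2 + B ^+ 2)%:E.
  rewrite ge0_integral_sum//.
  apply: (@le_trans _ _ (\sum_(j < n) (m ^+ 2 + (j == i)%:R * B ^+ 2)%:E)).
    apply: lee_sum => j _; have [->|ji] := eqVneq j i.
      rewrite mul1r (@le_trans _ _ (\int[P]_w (B ^+ 2)%:E))//.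
        apply: ge0_le_integral => //.
        by move=> w _; rewrite -EFinM lee_fin expr2 ler_pM.
      by rewrite integral_cst//= probability_setT mule1 lee_fin lerDr sqr_ge0.
    have := @independent_integralM _ _ _ _ _ P _ U i j (EFin \o f) (EFin \o f)
      iidU.1.
    move=> /= ->//; rewrite ?integral_fU -?EFinM ?mul0r ?addr0 ?expr2//.
    - by rewrite eq_sym.
    - exact/measurable_EFinP.
    - exact/measurable_EFinP.
  rewrite sumEFin big_split/= sumr_const card_ord -[(_ *+ n)%R]mulr_natl.
  rewrite (bigD1 i)//= eqxx mul1r big1 ?addr0// => j /negbTE ->.
  by rewrite mul0r.
apply: (@le_trans _ _ (\sum_(i < n) (n%:R * m ^+ 2 + B ^+ 2)%:E)).
  exact: lee_sum.
by rewrite sumEFin sumr_const card_ord lee_fin -[(_ *+ n)%R]mulr_natl.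
Qed.

Let mS n : measurable_fun setT (S n).
Proof. apply: measurable_sum => j. exact: mfU. Qed.

Let variance_S n : \int[P]_w ((S n w - n%:R * m) ^+ 2)%:E <= (n%:R * B ^+ 2)%:E.
Proof.
pose c := (n%:R * m)%R.
have c0 : (0 <= c)%R by rewrite mulr_ge0.
have S0 w : (0 <= S n w)%R by apply: sumr_ge0.
have mS2 : measurable_fun setT (fun w => ((S n w) ^+ 2)%:E).
  by apply/measurable_EFinP/measurable_funX.
have mSc : measurable_fun setT (fun w => ((S n w - c) ^+ 2)%:E).
  by apply/measurable_EFinP/measurable_funX/measurable_funB.
have mES : measurable_fun setT (fun w => (S n w)%:E) by exact/measurable_EFinP.
(* The square is expanded as an identity between sums of nonnegative terms,
   which integrates termwise without any integrability condition. *)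
have : \int[P]_w (((S n w - c) ^+ 2)%:E + (c *+ 2)%:E * (S n w)%:E) =
       \int[P]_w (((S n w) ^+ 2)%:E + (c ^+ 2)%:E).
  by apply: eq_integral => w _; rewrite -EFinM -!EFinD; congr EFin; ring.
rewrite ge0_integralD//; last 3 first.
- by move=> w _; rewrite lee_fin sqr_ge0.
- by move=> w _; rewrite -EFinM lee_fin mulr_ge0// mulrn_wge0.
- exact: measurable_funeM.
rewrite ge0_integralZl//; last 2 first.
- by move=> w _; rewrite lee_fin.
- by rewrite lee_fin mulrn_wge0.
rewrite ge0_integralD//; last 2 first.
- by move=> w _; rewrite lee_fin sqr_ge0.
- by move=> w _; rewrite lee_fin sqr_ge0.
rewrite integral_S integral_cst//= probability_setT mule1.
have := integral_S2 n; rewrite -/c.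
have : 0 <= \int[P]_w ((S n w - c) ^+ 2)%:E.
  by apply: integral_ge0 => w _; rewrite lee_fin sqr_ge0.
have : 0 <= \int[P]_w ((S n w) ^+ 2)%:E.
  by apply: integral_ge0 => w _; rewrite lee_fin sqr_ge0.
move: (\int[P]_w ((S n w) ^+ 2)%:E) (\int[P]_w ((S n w - c) ^+ 2)%:E).
case=> [a| |] [b| |]//=; rewrite ?leye_eq//.
rewrite !lee_fin -!EFinM -!EFinD => a0 b0 aB [] E.
by move: aB E; rewrite /c mulr2n; lra.
Qed.

(* Squared relative deviation of the partial sum of [k.+1 ^ 2] terms: its
   integral is at most [B ^ 2 / k.+1 ^ 2], which is summable. *)
Let dev k w : R := (((S (k.+1 ^ 2) w - (k.+1 ^ 2)%:R * m) / (k.+1 ^ 2)%:R) ^+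
  2)%R.

Let ae_dev : {ae P, forall w, dev k w @[k --> \oo] --> 0%R}.
Proof.
have mdev k : measurable_fun setT (dev k).
  by apply/measurable_funX/measurable_funM => //; exact: measurable_funB.
apply: ae_cvg0_summable_integral => // [k w|]; first exact: sqr_ge0.
have int_dev k : \int[P]_w (dev k w)%:E <= (B ^+ 2 * (k.+1%:R ^+ 2)^-1)%:E.
  pose N : R := ((k.+1 ^ 2)%:R)%R.
  have N0 : (0 < N)%R by rewrite /N ltr0n expn_gt0.
  have mE : measurable_fun setT
      (fun w => ((S (k.+1 ^ 2) w - (k.+1 ^ 2)%:R * m) ^+ 2)%:E).
    exact/measurable_EFinP/measurable_funX/measurable_funB.
  have -> : \int[P]_w (dev k w)%:E = (N ^- 2)%:E *
      \int[P]_w ((S (k.+1 ^ 2) w - (k.+1 ^ 2)%:R * m) ^+ 2)%:E.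
    rewrite -ge0_integralZl_EFin//; last 2 first.
    - by move=> w _; rewrite lee_fin sqr_ge0.
    - by rewrite invr_ge0 exprn_ge0// ltW.
    by apply: eq_integral => w _; rewrite -EFinM /dev exprMn mulrC exprVn.
  apply: (le_trans (lee_wpmul2l _ (variance_S _))).
    by rewrite lee_fin invr_ge0 exprn_ge0// ltW.
  rewrite -EFinM lee_fin -/N -natrX -/N le_eqVlt; apply/orP; left; apply/eqP.
  by field; rewrite gt_eqF.
apply: (@le_lt_trans _ _ (B ^+ 2 * 2)%:E); last exact: ltry.
apply: lime_le.
  by apply: is_cvg_nneseries => k _ _; apply: integral_ge0 => w _;
    rewrite lee_fin sqr_ge0.
apply: nearW => n; rewrite big_mkord.
apply: (@le_trans _ _ (\sum_(k < n) (B ^+ 2 * (k.+1%:R ^+ 2)^-1)%:E)).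
  by apply: lee_sum => k _; exact: int_dev.
rewrite sumEFin lee_fin -mulr_sumr ler_wpM2l ?sqr_ge0//.
exact: sum_invr_sqr_le.
Qed.

(** Along the squares, the variance bound is summable, which forces almost
    sure convergence; boundedness fills the gaps between the squares. *)
Lemma bounded_slln : {ae P, forall w,
  ((\sum_(j < n) f (U j w)) / n%:R)%R @[n --> \oo] -->
    fine (\int[Q]_t (f t)%:E)}.
Proof.
apply: filterS ae_dev => w devw.
apply: (@cvg_mean_from_squares _ (fun j => f (U j w)) _ B).
- by move=> j; rewrite f0 fB.
- by rewrite m0 mB.
move=> e e0.
have /cvgrPdist_lt/(_ (e ^+ 2)%R) := devw;
  rewrite exprn_gt0// => /(_ isT) [N _ Ne].
exists N.+1 => // -[|k]// Nk; have /= := Ne k Nk.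
have N0 : (0 < (k.+1 ^ 2)%:R :> R)%R by rewrite ltr0n expn_gt0.
rewrite sub0r normrN ger0_norm ?sqr_ge0// /dev -(real_normK (num_real _)).
rewrite ltr_pXn2r ?nnegrE ?normr_ge0 ?(ltW e0)// normrM => H.
rewrite -ler_pdivrMr// ltW//; move: H.
by rewrite [X in (_ * X < _)%R]ger0_norm// invr_ge0 ltW.
Qed.

End slln.

(** * Gamma distributions and the mean of a ratio *)

Section density.
Local Open Scope ereal_scope.
Context {R : realType} {d : measure_display} {T : measurableType d}.
Variables (mu nu : {measure set T -> \bar R}) (g : T -> R).
Hypotheses (g0 : forall x, (0 <= g x)%R) (mg : measurable_fun setT g).
Hypothesis nuE : forall B, measurable B -> nu B = \int[mu]_(x in B) (g x)%:E.

Import HBNNSimple.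

Let mEg : measurable_fun setT (fun x => (g x)%:E).
Proof. exact/measurable_EFinP. Qed.

Let Eg0 x : 0 <= (g x)%:E. Proof. by rewrite lee_fin. Qed.

Let density_nnsfun (f : {nnsfun T >-> R}) :
  \int[nu]_x (f x)%:E = \int[mu]_x ((f x)%:E * (g x)%:E).
Proof.
under [LHS]eq_integral do rewrite fimfunE -fsumEFin//.
rewrite [LHS]ge0_integral_fsum//; last 2 first.
- by move=> r; exact/measurable_EFinP/measurableT_comp.
- by move=> r x _; rewrite EFinM nnfun_muleindic_ge0.
transitivity (\int[mu]_x \sum_(r \in range f)
  ((r * \1_(f @^-1` [set r]) x)%:E * (g x)%:E)).
  rewrite ge0_integral_fsum//; last 2 first.
  - move=> r; apply: emeasurable_funM => //.
    exact/measurable_EFinP/measurableT_comp.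
  - by move=> r x _; rewrite mule_ge0// EFinM nnfun_muleindic_ge0.
  apply: eq_fsbigr => r _.
  have [r0|r0] := ltP r 0%R.
    rewrite !integral0_eq// => x _;
      rewrite preimage_nnfun0// indicE in_set0 mulr0//.
    by rewrite mul0e.
  have mfr : measurable (f @^-1` [set r]) by [].
  rewrite (integralZl_indic _ (fun r => f @^-1` [set r]))//; last first.
    by move=> r1; rewrite preimage_nnfun0.
  rewrite integral_indic// setIT nuE//.
  under [RHS]eq_integral do rewrite EFinM -muleA.
  rewrite ge0_integralZl_EFin//; last 2 first.
  - by move=> x _; rewrite mule_ge0// lee_fin.
  - by apply: emeasurable_funM => //; exact/measurable_EFinP.
  congr (_ * _); rewrite integral_mkcond; apply: eq_integral => x _.
  by rewrite patchE indicE; case: ifPn => _; rewrite ?mul1e ?mul0e.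
apply: eq_integral => x _; rewrite -ge0_mule_fsuml; last first.
  by move=> r; rewrite EFinM nnfun_muleindic_ge0.
by rewrite fimfunE -fsumEFin.
Qed.

Lemma ge0_integral_density (f : T -> \bar R) : (forall x, 0 <= f x) ->
  measurable_fun setT f -> \int[nu]_x f x = \int[mu]_x (f x * (g x)%:E).
Proof.
move=> f0 mf; pose f_ := nnsfun_approx measurableT mf.
have mEf_ n : measurable_fun setT (EFin \o f_ n) by exact/measurable_EFinP.
transitivity (\int[nu]_x (lim ((f_ n x)%:E @[n --> \oo]))).
  by apply/eq_integral => x _; apply/esym/cvg_lim => //=;
    exact: cvg_nnsfun_approx.
rewrite monotone_convergence//; last 2 first.
- by move=> n x _; rewrite lee_fin.
- by move=> x _ k l kl; rewrite lee_fin; exact/lefP/nd_nnsfun_approx.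
rewrite (_ : (fun _ => _) = (fun n => \int[mu]_x ((f_ n x)%:E * (g x)%:E)));
  last first.
  by apply/funext => n; rewrite density_nnsfun.
rewrite -monotone_convergence//; last 3 first.
- by move=> n; apply: emeasurable_funM => //; exact: mEf_.
- by move=> n x _; rewrite mule_ge0// lee_fin.
- move=> x _ k l kl; rewrite lee_wpmul2r// lee_fin.
  exact/lefP/nd_nnsfun_approx.
apply: eq_integral => x _; apply/cvg_lim => //.
apply: cvgeZr => //; exact: cvg_nnsfun_approx.
Qed.

End density.

Section gamma_parts.
Local Open Scope ereal_scope.
Context {R : realType}.
Local Notation mu := (@lebesgue_measure R).

Lemma integral_expR_tail (c t : R) : (0 < c)%R ->
  \int[mu]_(s in `[t, +oo[) (c * expR (- (c * s)))%:E = (expR (- (c * t)))%:E.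
Proof.
move=> c0.
have dF (x : R) : is_derive x (1%R : R) (fun s : R => - expR (- (c * s)))%R
  (c * expR (- (c * x)))%R.
  apply: is_derive_eq; rewrite /GRing.scale/=; ring.
have cF : continuous (fun s : R => - expR (- (c * s)))%R.
  by move=> x; apply/differentiable_continuous/derivable1_diffP;
    exact: (@ex_derive _ _ _ _ _ _ _ (dF x)).
rewrite (@ge0_continuous_FTC2y _ _ (fun s => - expR (- (c * s)))%R t 0%R).
- by rewrite EFinN oppeK add0e.
- by move=> x _; rewrite mulr_ge0 ?expR_ge0// ltW.
- apply: continuous_subspaceT => x.
  apply: cvgM; first exact: cvg_cst.
  apply: continuous_comp; last exact: continuous_expR.
  by apply: cvgN; apply: cvgM; [exact: cvg_cst|exact: cvg_id].
- rewrite -oppr0; apply: cvgN.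
  apply: (@cvg_comp _ _ _ (fun s => c * s)%R (fun s => expR (- s))%R _
    (pinfty_nbhs R)); last exact: cvgr_expR.
  exact: gt0_cvgMry.
- by move=> x _; exact: (@ex_derive _ _ _ _ _ _ _ (dF x)).
- exact: cvg_at_right_filter (cF t).
- by move=> x _; rewrite derive1E; exact: (@derive_val _ _ _ _ _ _ _ (dF x)).
Qed.

Lemma continuous_powR (b x : R) : (0 < x)%R ->
  {for x, continuous (fun t : R => t `^ b)%R}.
Proof.
move=> x0; apply/differentiable_continuous/derivable1_diffP.
by apply: derivable_powR; rewrite in_itv/= x0.
Qed.

(** The integrand may blow up at 0, so the fundamental theorem of calculus is
    applied on [[s / n.+2, s]], and [n] tends to infinity. *)
Lemma integral_powR_itv0 (a s : R) : (0 < a)%R -> (0 < s)%R ->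
  \int[mu]_(t in `]0%R, s]) (a * t `^ (a - 1))%:E = (s `^ a)%:E.
Proof.
move=> a0 s0.
pose r n : R := (s / n.+2%:R)%R.
have r0 n : (0 < r n)%R by rewrite divr_gt0.
have rs n : (r n < s)%R by rewrite ltr_pdivrMr// ltr_pMr// ltr1n.
pose F n : set R := `[r n, s]%classic.
have mpow : measurable_fun setT (fun t : R => a * t `^ (a - 1))%R.
  by apply: measurable_funM => //; exact: measurable_powR.
have FE : \bigcup_n F n = `]0%R, s]%classic.
  apply/seteqP; split=> [t [n _]|t]; rewrite /F/= !in_itv/= => /andP[lt ts].
    by rewrite ts (lt_le_trans (r0 n)).
  have [n _ nt] := near_infty_natSinv_lt (PosNum (divr_gt0 lt s0)).
  exists n => //; rewrite /= in_itv/= ts andbT /r mulrC -ler_pdivlMr// ltW//.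
  apply: le_lt_trans (nt n _) => //=.
  by rewrite lef_pV2 ?posrE// ler_nat.
have ndF : nondecreasing_seq F.
  move=> m n mn; rewrite subsetEset => t;
    rewrite /F/= !in_itv/= => /andP[rt ->].
  rewrite andbT (le_trans _ rt)// /r ler_pM2l// lef_pV2 ?posrE//.
  by rewrite ler_nat !ltnS.
have : \int[mu]_(t in F n) (a * t `^ (a - 1))%:E @[n --> \oo] -->
    \int[mu]_(t in \bigcup_n F n) (a * t `^ (a - 1))%:E.
  apply: ge0_nondecreasing_set_cvg_integral => //.
  - by move=> n; exact: measurable_itv.
  - by move=> n; apply/measurable_EFinP; apply: measurable_funTS.
  - by move=> n x _; rewrite lee_fin mulr_ge0 ?powR_ge0// ltW.
rewrite FE => /cvg_lim <-//; apply/cvg_lim => //.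
have intF n : \int[mu]_(t in F n) (a * t `^ (a - 1))%:E
  = (s `^ a - r n `^ a)%:E.
  rewrite (@continuous_FTC2 _ _ (fun t => t `^ a)%R)//.
  - apply: continuous_in_subspaceT => t;
    rewrite mem_setE in_itv/= => /andP[rt _].
    apply: cvgM; first exact: cvg_cst.
    by apply: continuous_powR; exact: lt_le_trans rt.
  - split.
    + move=> t; rewrite in_itv/= => /andP[rt _]; apply: derivable_powR.
      by rewrite in_itv/= (lt_trans _ rt).
    + by apply: cvg_at_right_filter; exact: continuous_powR.
    + by apply: cvg_at_left_filter; exact: continuous_powR.
  - move=> t; rewrite in_itv/= => /andP[rt _]; apply: powR_derive1.
    by rewrite in_itv/= (lt_trans _ rt).
under eq_fun do rewrite intF.
apply/fine_cvgP; split; first exact: nearW.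
rewrite /comp/=.
rewrite -[X in _ --> X]subr0.
apply: (@cvgB _ _ _ _ _ (fun=> s `^ a)%R (fun n => r n `^ a)%R);
  first exact: cvg_cst.
have := powR_cvg0 a0; move=> /cvg_at_rightP; apply; split=> //.
rewrite -(mulr0 s); apply: cvgM; first exact: cvg_cst.
by have := @cvg_harmonic R; rewrite -cvg_shiftS.
Qed.

(** Integration by parts of [t `^ a] against [expR (- (c * t))], obtained by
    integrating [a * t `^ (a - 1) * (c * expR (- (c * s)))] over [0 < t <= s]
    in both orders, so that boundary terms never appear. *)
Lemma gamma_parts (a c : R) : (0 < a)%R -> (0 < c)%R ->
  \int[mu]_(t in `]0%R, +oo[) (c * t `^ a * expR (- (c * t)))%:E =
  \int[mu]_(t in `]0%R, +oo[) (a * t `^ (a - 1) * expR (- (c * t)))%:E.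
Proof.
move=> a0 c0.
pose p (t : R) := (a * t `^ (a - 1))%R.
pose q (s : R) := (c * expR (- (c * s)))%R.
have p0 t : (0 <= p t)%R by rewrite mulr_ge0 ?powR_ge0// ltW.
have q0 t : (0 <= q t)%R by rewrite mulr_ge0 ?expR_ge0// ltW.
have mp : measurable_fun setT p.
  by apply: measurable_funM => //; exact: measurable_powR.
have mq : measurable_fun setT q.
  apply: measurable_funM => //; apply: measurableT_comp => //.
  by apply: measurable_funN; exact: measurable_funM.
pose K (z : R * R) : bool := (0 < z.1 <= z.2)%R.
pose F (z : R * R) : \bar R := ((K z)%:R * (p z.1 * q z.2))%:E.
have mF : measurable_fun setT F.
  have -> : F = fun z => (if (0 < z.1) && (z.1 <= z.2) then p z.1 * q z.2 else
    0)%R%:E.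
    by apply/funext => z; rewrite /F /K; case: ifP; rewrite ?mul1r ?mul0r.
  apply/measurable_EFinP; apply: measurable_fun_ifT => //.
    apply: measurable_and.
      exact: measurable_fun_ltr.
    exact: measurable_fun_ler.
  by apply: measurable_funM; exact: measurableT_comp.
have F0 z : 0 <= F z by rewrite lee_fin; apply: mulr_ge0 => //; exact: mulr_ge0.
have FE := @fubini_tonelli _ _ _ _ R mu mu F mF F0.
have E1 : \int[mu]_s \int[mu]_t F (t, s) =
    \int[mu]_(s in `]0%R, +oo[) (c * s `^ a * expR (- (c * s)))%:E.
  rewrite [RHS]integral_mkcond; apply: eq_integral => s _.
  rewrite patchE mem_setE in_itv/= andbT; case: ltP => s0; last first.
    apply: integral0_eq => t _; rewrite /F.
    suff -> : K (t, s) = false by rewrite mul0r.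
    by apply/negbTE/negP => /andP[/= t0 ts]; move: (lt_le_trans t0 ts);
      rewrite ltNge s0.
  have -> : (c * s `^ a * expR (- (c * s)))%:E = (q s)%:E * (s `^ a)%:E.
    by rewrite -EFinM /q mulrAC.
  rewrite -(integral_powR_itv0 a0 s0) -ge0_integralZl_EFin; last 4 first.
  - exact: measurable_itv.
  - by move=> t _; rewrite lee_fin p0.
  - by apply/measurable_EFinP; exact: measurable_funTS.
  - exact: q0.
  rewrite [RHS]integral_mkcond; apply: eq_integral => t _.
  rewrite patchE mem_setE in_itv/= /F /K/=; case: ifP => _.
    by rewrite mul1r -EFinM mulrC.
  by rewrite mul0r.
rewrite -E1 -FE [RHS]integral_mkcond; apply: eq_integral => t _.
rewrite patchE mem_setE in_itv/= andbT; case: ltP => t0; last first.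
  by apply: integral0_eq => s _; rewrite /F /K/= ltNge t0 mul0r.
rewrite EFinM -(integral_expR_tail _ c0) -ge0_integralZl_EFin; last 4 first.
- exact: measurable_itv.
- by move=> s _; rewrite lee_fin q0.
- by apply/measurable_EFinP; exact: measurable_funTS.
- exact: p0.
rewrite [RHS]integral_mkcond; apply: eq_integral => s _.
rewrite patchE mem_setE in_itv/= andbT /F /K/= t0/=; case: ifP => _.
  by rewrite mul1r.
by rewrite mul0r.
Qed.

End gamma_parts.

Lemma Gamma_ge0 (R : realType) (a : R) : 0 <= Gamma a.
Proof.
apply: fine_ge0; apply: integral_ge0 => t _.
by rewrite lee_fin mulr_ge0 ?powR_ge0 ?expR_ge0.
Qed.

Section gamma_law_moments.
Local Open Scope ereal_scope.
Context {R : realType} {d : measure_display} {W : measurableType d}.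
Local Notation mu := (@lebesgue_measure R).
Variables (P : probability W R) (X : {RV P >-> R}) (a : R).
Hypothesis lawX : forall B, measurable B -> distribution P X B = gamma_law a B.

Let dens (t : R) : R := if (0 < t)%R then
  (t `^ (a - 1) * expR (- t) / Gamma a)%R else 0%R.

Let dens_ge0 t : (0 <= dens t)%R.
Proof.
rewrite /dens; case: ifP => // _.
by rewrite divr_ge0 ?Gamma_ge0// mulr_ge0 ?powR_ge0 ?expR_ge0.
Qed.

Let mdens : measurable_fun setT dens.
Proof.
apply: measurable_fun_ifT => //; first exact: measurable_fun_ltr.
apply: measurable_funM => //; apply: measurable_funM;
  first exact: measurable_powR.
by apply: measurableT_comp => //; exact: measurable_funN.
Qed.

Lemma ge0_integral_gamma_law (f : R -> \bar R) : a != 0%R ->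
  (forall x, 0 <= f x) ->
  measurable_fun setT f -> \int[P]_w f (X w) =
  \int[mu]_(t in `]0%R, +oo[) (f t * (t `^ (a - 1) * expR (- t) / Gamma a)%:E).
Proof.
move=> a0 f0 mf.
(* Lebesgue measure lives on [measurableTypeR R], which has the same measurable
   sets as [R] but is a different measurable type; [X'] is [X] seen there. *)
have mX' : @measurable_fun _ _ W (measurableTypeR R) setT X
  by exact: (@measurable_funPT _ _ _ _ X).
pose X' : {mfun W >-> measurableTypeR R} := HB.pack (X : W -> measurableTypeR R)
  (isMeasurableFun.Build _ _ _ (measurableTypeR R) _ mX').
rewrite -(@ge0_integral_distribution _ _ W (measurableTypeR R) _ P X' f mf f0).
rewrite (@ge0_integral_density R _ (measurableTypeR R) mu (distribution P X')
  dens)//; last first.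
  move=> B mB; rewrite [LHS](lawX mB) /gamma_law (negbTE a0).
  rewrite integral_mkcondr; apply: eq_integral => t _.
  by rewrite patchE mem_setE in_itv/= andbT /dens; case: ifP.
rewrite [RHS]integral_mkcond; apply: eq_integral => t _.
by rewrite patchE mem_setE in_itv/= andbT /dens; case: ifP => // _;
  rewrite mule0.
Qed.

Lemma gamma_law_ge0 : {ae P, forall w, (0 <= X w)%R}.
Proof.
exists (X @^-1` `]-oo, 0%R[); split; first exact: measurable_funPTI.
- rewrite -[LHS]/(distribution P X _) lawX// /gamma_law; case: eqP => _.
    by rewrite diracE memNset//= in_itv/= ltxx.
  suff -> : `]-oo, 0%R[ `&` `]0%R, +oo[ = set0 :> set R.
    by rewrite integral_set0.
  apply/seteqP; split=> // t [] /=;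
    rewrite !in_itv/= andbT => t0 /(lt_trans t0).
  by rewrite ltxx.
- by move=> w /= /negP; rewrite in_itv/= -ltNge.
Qed.

Lemma gamma_law_gt0 : a != 0%R -> {ae P, forall w, (0 < X w)%R}.
Proof.
move=> /negbTE a0.
exists (X @^-1` `]-oo, 0%R]); split; first exact: measurable_funPTI.
- rewrite -[LHS]/(distribution P X _) lawX// /gamma_law a0.
  suff -> : `]-oo, 0%R] `&` `]0%R, +oo[ = set0 :> set R.
    by rewrite integral_set0.
  apply/seteqP; split=> // t [] /=;
    rewrite !in_itv/= andbT => t0 /(le_lt_trans t0).
  by rewrite ltxx.
- by move=> w /= /negP; rewrite in_itv/= -leNgt.
Qed.

(** The normalizing constant of the density never has to be computed: it
    cancels, and [gamma_parts] at rate [1 + lam] gives the factor. *)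
Lemma gamma_law_size_bias (lam : R) : (0 <= a)%R -> (0 <= lam)%R ->
  \int[P]_w (Num.max (X w) 0 * expR (- (lam * X w)))%:E =
  (a / (1 + lam))%:E * \int[P]_w (expR (- (lam * X w)))%:E.
Proof.
move=> a_ge0 lam0.
have mexp : measurable_fun setT (fun t : R => expR (- (lam * t)))%R.
  by apply: measurableT_comp => //; apply: measurable_funN;
    exact: measurable_funM.
have mmax : measurable_fun setT
  (fun t : R => Num.max t 0 * expR (- (lam * t)))%R.
  by apply: measurable_funM => //; exact: measurable_maxr.
have [a0|a0] := eqVneq a 0%R.
  rewrite a0 mul0r mul0e.
  have : {ae P, forall w, X w = 0%R}.
    exists (X @^-1` ~` [set 0%R]); split.
    - by apply: measurable_funPTI; exact: measurableC.
    - rewrite -[LHS]/(distribution P X _) lawX; last exact: measurableC.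
      by rewrite /gamma_law a0 eqxx diracE memNset//=; exact.
    - by move=> w.
  move=> X0; rewrite (ae_eq_integral (cst 0))//; first by rewrite integral0.
    by apply/measurable_EFinP; exact: (measurableT_comp mmax).
  by apply: filterS X0 => w -> _; rewrite /= maxxx mul0r.
have apos : (0 < a)%R by rewrite lt_neqAle eq_sym a0.
have c0 : (0 < 1 + lam)%R by rewrite ltr_wpDr.
rewrite (ge0_integral_gamma_law
  (f := fun t => (Num.max t 0 * expR (- (lam * t)))%:E)); last 3 first.
- exact: a0.
- by move=> t; rewrite lee_fin mulr_ge0 ?expR_ge0// le_max lexx orbT.
- exact/measurable_EFinP.
rewrite (ge0_integral_gamma_law (f := fun t => (expR (- (lam * t)))%:E));
  last 3 first.
- exact: a0.
- by move=> t; rewrite lee_fin expR_ge0.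
- exact/measurable_EFinP.
have G0 := Gamma_ge0 a.
have expD t : (expR (- ((1 + lam) * t)) = expR (- (lam * t)) * expR (- t))%R.
  by rewrite -expRD; congr expR; ring.
have mpe b : measurable_fun setT
  (fun t : R => t `^ b * expR (- ((1 + lam) * t)))%R.
  apply: measurable_funM; first exact: measurable_powR.
  by apply: measurableT_comp => //; apply: measurable_funN;
    exact: measurable_funM.
transitivity (((1 + lam)^-1 / Gamma a)%:E *
   \int[mu]_(t in `]0%R, +oo[)
     ((1 + lam) * t `^ a * expR (- ((1 + lam) * t)))%:E).
  rewrite -ge0_integralZl_EFin; last 4 first.
  - exact: measurable_itv.
  - by move=> t _; rewrite lee_fin !mulr_ge0 ?powR_ge0 ?expR_ge0// ltW.
  - apply/measurable_EFinP/measurable_funTS.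
    under eq_fun do rewrite -mulrA.
    by apply: measurable_funM => //; exact: mpe.
  - by rewrite divr_ge0 ?invr_ge0// ltW.
  apply: eq_integral => t; rewrite mem_setE in_itv/= andbT => t0.
  rewrite -!EFinM max_l ?ltW// expD; congr EFin.
  have -> : (t `^ a = t * t `^ (a - 1))%R.
    rewrite -{1}(subrK 1%R a) [LHS]powRD; last by rewrite lt0r_neq0 ?implybT.
    by rewrite powRr1 ?ltW// mulrC.
  have key (k G s p e f : R) : (0 < k)%R ->
      (k^-1 / G * (k * (s * p) * (e * f)) = s * e * (p * f / G))%R.
    move=> k0; transitivity (k^-1 * k * (s * e * (p * f / G)))%R; first by ring.
    by rewrite mulVf ?gt_eqF// mul1r.
  by apply/esym/key.
rewrite (gamma_parts apos c0).
rewrite -!ge0_integralZl_EFin; last 8 first.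
- exact: measurable_itv.
- by move=> t _; rewrite -EFinM lee_fin !mulr_ge0 ?invr_ge0 ?powR_ge0 ?expR_ge0.
- apply: measurable_funTS; apply: emeasurable_funM;
  apply/measurable_EFinP => //.
  apply: measurable_funM => //; apply: measurable_funM;
    first exact: measurable_powR.
  by apply: measurableT_comp => //; exact: measurable_funN.
- by rewrite divr_ge0// ltW.
- exact: measurable_itv.
- by move=> t _; rewrite lee_fin !mulr_ge0 ?powR_ge0 ?expR_ge0.
- apply/measurable_EFinP/measurable_funTS.
  under eq_fun do rewrite -mulrA.
  by apply: measurable_funM => //; exact: mpe.
- by rewrite divr_ge0 ?invr_ge0// ltW.
apply: eq_integral => t _.
rewrite -!EFinM expD; congr EFin; ring.
Qed.

End gamma_law_moments.

Section gamma_ratio.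
Local Open Scope ereal_scope.
Context {R : realType}.
Local Notation mu := (@lebesgue_measure R).

Lemma measurable_invr : measurable_fun [set: R] (fun x : R => x^-1)%R.
Proof.
have -> : (fun x : R => x^-1)%R = (fun x : R => x * (x ^+ 2) `^ (-1))%R.
  apply/funext => x; rewrite powR_inv1 ?sqr_ge0//.
  have [->|x0] := eqVneq x 0%R; first by rewrite invr0 mul0r.
  by rewrite expr2 invfM mulrA divff// mul1r.
apply: measurable_funM => //.
apply: (@measurableT_comp _ _ _ _ _ _ (fun y : R => y `^ (-1))%R) => //.
Qed.

Context {d : measure_display} {W : measurableType d} (P : probability W R).
Context {I : choiceType} (Z : I -> {RV P >-> R}) (a : I -> R).
Hypothesis indZ : mutually_independent Z.
Hypothesis lawZ : forall i B, measurable B -> distribution P (Z i) B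
  = gamma_law (a i) B.
Hypothesis a_ge0 : forall i, (0 <= a i)%R.

(* Laplace transform of [Z i]. *)
Let M i (l : R) := \int[P]_w (expR (- (l * Z i w)))%:E.

Let K i j := \int[mu]_(l in `[0%R, +oo[) ((1 + l)^-1%:E * (M i l * M j l)).

Let mexp (l : R) : measurable_fun setT (fun t : R => expR (- (l * t)))%R.
Proof. by apply: measurableT_comp => //; apply: measurable_funN;
  exact: measurable_funM. Qed.

Let K_sym i j : K i j = K j i.
Proof. by apply: eq_integral => l _; rewrite (muleC (M i l)). Qed.

Let S_gt0 i j : (0 < a i + a j)%R -> {ae P, forall w, (0 < Z i w + Z j w)%R}.
Proof.
move=> aij; have Zi0 := gamma_law_ge0 (lawZ i);
  have Zj0 := gamma_law_ge0 (lawZ j).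
have [ai0|ai0] := eqVneq (a i) 0%R.
  have aj0 : a j != 0%R by move: aij; rewrite ai0 add0r => /lt0r_neq0.
  by have := gamma_law_gt0 (lawZ j) aj0; apply: filterS2 Zi0 => w Ziw;
    exact: ltr_wpDl.
by have := gamma_law_gt0 (lawZ i) ai0; apply: filterS2 Zj0 => w Zjw;
  exact: ltr_wpDr.
Qed.

Let mratio i j : measurable_fun setT (fun w => (Z i w / (Z i w + Z j w))%:E).
Proof.
apply/measurable_EFinP; apply: measurable_funM => //.
apply: (measurableT_comp measurable_invr); exact: measurable_funD.
Qed.

Let mM i : measurable_fun setT (M i).
Proof.
pose G (z : W * R) := (expR (- (z.2 * Z i z.1)))%:E.
apply: (@measurable_fun_fubini_tonelli_G _ _ _ _ _ P G).
- apply/measurable_EFinP; apply: measurableT_comp => //; apply: measurable_funN.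
  by apply: measurable_funM => //; exact: measurableT_comp.
- by move=> z; rewrite lee_fin expR_ge0.
Qed.

(* Write [1 / S] as the integral of [expR (- (l * S))] over [l >= 0]. For each
   [l], independence separates [Z i] from [Z j], and the size-bias identity
   turns the factor [Z i] into [a i / (1 + l)]. What remains, [K i j], is
   symmetric in [i] and [j]. *)
Let integral_ratio i j : i != j -> (0 < a i + a j)%R ->
  \int[P]_w (Z i w / (Z i w + Z j w))%:E = (a i)%:E * K i j.
Proof.
move=> ij aij.
pose F (z : W * R) : \bar R := (if (0 <= z.2)%R then
  Num.max (Z i z.1) 0 * expR (- (z.2 * Z i z.1)) * expR (- (z.2 * Z j z.1)) else
    0)%R%:E.
have F0 z : 0 <= F z.
  rewrite lee_fin; case: ifP => // _.
  by rewrite !mulr_ge0 ?expR_ge0// le_max lexx orbT.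
have mF : measurable_fun setT F.
  have mZ k : measurable_fun setT (fun z : W * R => Z k z.1)
    by exact: measurableT_comp.
  have me k : measurable_fun setT (fun z : W * R => expR (- (z.2 * Z k z.1))).
    by apply: measurableT_comp => //; apply: measurable_funN;
      exact: measurable_funM.
  apply/measurable_EFinP; apply: measurable_fun_ifT => //.
    exact: measurable_fun_ler.
  apply: measurable_funM => //; apply: measurable_funM => //.
  exact: measurable_maxr.
have inner : {ae P, forall w, (Z i w / (Z i w + Z j w))%:E
  = \int[mu]_l F (w, l)}.
  apply: filterS2 (gamma_law_ge0 (lawZ i)) (S_gt0 aij) => w Ziw Sw.
  rewrite -[LHS]mule1 -[X in _ * X%:E]expR0 -oppr0
    -[X in (- X)%R](mulr0 (Z i w + Z j w)%R).
  rewrite -(integral_expR_tail 0 Sw) -ge0_integralZl_EFin; last 4 first.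
  - exact: measurable_itv.
  - by move=> l _; rewrite lee_fin mulr_ge0 ?expR_ge0// ltW.
  - apply: measurable_funTS; apply/measurable_EFinP;
    apply: measurable_funM => //.
    exact: mexp.
  - by rewrite divr_ge0// ltW.
  rewrite [LHS]integral_mkcond; apply: eq_integral => l _.
  rewrite patchE mem_setE in_itv/= andbT /F/=; case: ifP => // _.
  rewrite -EFinM max_l//; congr EFin.
  rewrite -[RHS]mulrA -expRD -opprD -mulrDr [(l * _)%R]mulrC mulrA divfK//.
  by rewrite gt_eqF.
rewrite (ae_eq_integral (fun w => \int[mu]_l F (w, l)))//; last 2 first.
- exact: measurable_fun_fubini_tonelli_F.
- by apply: filterS inner => w ->.
rewrite [LHS](@fubini_tonelli _ _ _ _ R P mu F mF F0) /K -ge0_integralZl_EFin;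
  last 4 first.
- exact: measurable_itv.
- move=> l; rewrite /= in_itv/= andbT => l0; rewrite !mule_ge0//.
  + by rewrite lee_fin invr_ge0 addr_ge0.
  + by apply: integral_ge0 => w _; rewrite lee_fin expR_ge0.
  + by apply: integral_ge0 => w _; rewrite lee_fin expR_ge0.
- apply: measurable_funTS; apply: emeasurable_funM; last first.
    exact: (emeasurable_funM (mM i) (mM j)).
  apply/measurable_EFinP; apply: (measurableT_comp measurable_invr).
  exact: measurable_funD.
- exact: a_ge0.
rewrite [RHS]integral_mkcond; apply: eq_integral => l _.
rewrite patchE mem_setE in_itv/= andbT; have [l0|l0] := leP 0%R l; last first.
  by apply: integral0_eq => w _; rewrite /F/= leNgt l0.
transitivity (\int[P]_w ((Num.max (Z i w) 0 * expR (- (l * Z i w)))%:E *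
    (expR (- (l * Z j w)))%:E)).
  by apply: eq_integral => w _; rewrite /F/= l0.
have := @independent_integralM _ _ _ _ _ P _ Z i j
  (fun t => (Num.max t 0 * expR (- (l * t)))%:E)
    (fun t => (expR (- (l * t)))%:E) indZ ij.
move=> ->; last 4 first.
- apply/measurable_EFinP; apply: measurable_funM => //; exact: measurable_maxr.
- exact/measurable_EFinP.
- by move=> t; rewrite lee_fin mulr_ge0 ?expR_ge0// le_max lexx orbT.
- by move=> t; rewrite lee_fin expR_ge0.
rewrite (gamma_law_size_bias (lawZ i))//.
by rewrite EFinM -!muleA.
Qed.

(** The two ratios have means [a i * K] and [a j * K] for the same [K], and they
    add up to 1; this determines [K]. The absolute value is there because the
    ratios are nonnegative only almost surely. *)
Lemma gamma_ratio_mean i j : i != j -> (0 < a i + a j)%R ->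
  \int[P]_w `|Z i w / (Z i w + Z j w)|%:E = (a i / (a i + a j))%:E.
Proof.
move=> ij aij; have aji : (0 < a j + a i)%R by rewrite addrC.
have ji : j != i by rewrite eq_sym.
have := integral_ratio ij aij; have := integral_ratio ji aji; rewrite K_sym.
have mabs k l : measurable_fun setT (fun w => `|Z k w / (Z k w + Z l w)|%:E).
  apply/measurable_EFinP; apply:
    (@measurableT_comp _ _ _ _ _ _ (fun x : R => `|x|%R)) => //.
  by have /measurable_EFinP := mratio k l.
have absratio k l : (0 < a k + a l)%R ->
    \int[P]_w `|Z k w / (Z k w + Z l w)|%:E
      = \int[P]_w (Z k w / (Z k w + Z l w))%:E.
  move=> akl; apply: ae_eq_integral;
    [exact: measurableT|exact: mabs|exact: mratio|].
  apply: filterS2 (gamma_law_ge0 (lawZ k)) (S_gt0 akl) => w Zk Sw _.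
  by rewrite ger0_norm// divr_ge0// ltW.
have : \int[P]_w (`|Z i w / (Z i w + Z j w)|%:E + `|Z j w / (Z j w + Z i w)|%:E)
  = 1.
  rewrite (ae_eq_integral (cst 1)); last 4 first.
  - exact: measurableT.
  - by apply: emeasurable_funD; exact: mabs.
  - by [].
  - apply: filterS3 (gamma_law_ge0 (lawZ i)) (gamma_law_ge0 (lawZ j))
    (S_gt0 aij).
    move=> w Zi Zj Sw _; rewrite /= (addrC (Z j w)) !ger0_norm ?divr_ge0//
      ?(ltW Sw)//.
    by rewrite -EFinD -mulrDl divff// gt_eqF.
  by rewrite integral_cst//= probability_setT mule1.
rewrite ge0_integralD; last 5 first.
- exact: measurableT.
- by move=> w _; rewrite lee_fin.
- exact: mabs.
- by move=> w _; rewrite lee_fin.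
- exact: mabs.
rewrite !absratio// => sum1 jE ->; move: sum1; rewrite integral_ratio// jE.
have : 0 <= K i j.
  apply: integral_ge0 => l; rewrite /= in_itv/= andbT => l0;
    rewrite !mule_ge0//.
  + by rewrite lee_fin invr_ge0 addr_ge0.
  + by apply: integral_ge0 => w _; rewrite lee_fin expR_ge0.
  + by apply: integral_ge0 => w _; rewrite lee_fin expR_ge0.
rewrite -ge0_muleDl ?lee_fin// -EFinD; case: (K i j) => [k _|_|]//.
  rewrite -!EFinM => -[sum1]; congr EFin.
  by rewrite -[RHS]mulr1 -[X in _ = (_ * X)%R]sum1 mulrA divfK ?gt_eqF.
by rewrite gt0_muley ?lte_fin.
Qed.

End gamma_ratio.

(** * Mean measure of a Dirichlet process *)

Section bounded_shift.
Local Open Scope ereal_scope.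
Context {R : realType} {d : measure_display} {T : measurableType d}.
Variables (B : set T) (f : T -> R) (M : R).
Hypotheses (mB : measurable B) (mf : measurable_fun setT f).
Hypothesis fM : forall t, B t -> (`|f t| <= M)%R.

(** A nonnegative bounded substitute for [f], for probabilities carried by [B]:
    Tonelli-type identities apply to it directly, and subtracting [M] recovers
    the integral of [f]. *)
Definition shift_on (t : T) : R := ((f t + M) * \1_B t)%R.

Lemma shift_on_ge0 t : (0 <= shift_on t)%R.
Proof.
rewrite /shift_on indicE; have [/set_mem/fM|_] := boolP (t \in B);
  last by rewrite mulr0.
by rewrite mulr1 ler_norml => /andP[? _]; lra.
Qed.

Lemma shift_on_le t : (shift_on t <= 2 * `|M|)%R.
Proof.
rewrite /shift_on indicE; have [/set_mem/fM|_] := boolP (t \in B);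
  last by rewrite mulr0 mulr_ge0.
have := ler_norm M; have := normr_ge0 M.
by rewrite mulr1 ler_norml => ? ? /andP[? ?]; lra.
Qed.

Lemma measurable_shift_on : measurable_fun setT shift_on.
Proof. by apply: measurable_funM => //; exact: measurable_funD. Qed.

Let mEg : measurable_fun setT (fun t => (shift_on t)%:E).
Proof. by apply/measurable_EFinP; exact: measurable_shift_on. Qed.

Lemma integral_shift_on_le (p : probability T R) :
  \int[p]_t (shift_on t)%:E <= (2 * `|M|)%:E.
Proof.
apply: (@le_trans _ _ (\int[p]_t (2 * `|M|)%:E)).
  apply: ge0_le_integral => //.
  - by move=> t _; rewrite lee_fin shift_on_ge0.
  - by move=> t _; rewrite lee_fin shift_on_le.
by rewrite integral_cst//= probability_setT mule1.
Qed.

Lemma integral_shift_on (p : probability T R) : p B = 1 ->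
  \int[p]_t (f t)%:E = \int[p]_t (shift_on t)%:E - M%:E.
Proof.
move=> pB.
have -> : \int[p]_t (f t)%:E = \int[p]_t ((shift_on t)%:E - M%:E).
  apply: ae_eq_integral => //.
  - exact/measurable_EFinP.
  - apply/measurable_EFinP; apply: measurable_funB => //.
    exact: measurable_shift_on.
  exists (~` B); split; first exact: measurableC.
    by apply: etrans (probability_setC p mB) _; rewrite pB subee.
  move=> t /= nt Bt; apply: nt => _.
  by rewrite /shift_on indicE mem_set// mulr1 -EFinB addrK.
rewrite integralB_EFin//; last 2 first.
- apply/integrableP; split=> //.
  rewrite (eq_integral (fun t => (shift_on t)%:E)).
    exact: le_lt_trans (integral_shift_on_le p) (ltry _).
  by move=> t _; rewrite /= ger0_norm ?shift_on_ge0.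
- exact: finite_measure_integrable_cst.
by rewrite integral_cst//= probability_setT mule1.
Qed.

End bounded_shift.

Section dirichlet_process_mean.
Local Open Scope ereal_scope.
Context {R : realType} {d : measure_display} {T : measurableType d}.
Variables (pi : probability (pprobability T R) R).

Lemma measurable_evaluation (A : set T) : measurable A ->
  measurable_fun setT (fun p : pprobability T R => p A).
Proof.
by move=> mA; have := measurable_kernel
  (kprobability (@measurable_id _ (pprobability T R) setT)) A mA.
Qed.

(** For the partition of [T] into [A] and its complement, [p A] has the law of
    [Z_0 / (Z_0 + Z_1)] with independent Gamma variables whose shapes are
    proportional to [Q A] and [1 - Q A]. *)
Lemma dirichlet_process_mean (a : R) (Q : probability T R) (A : set T) :
  (0 < a)%R -> is_dirichlet_process a Q pi -> measurable A ->
  \int[pi]_p p A = Q A.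
Proof.
move=> a0 dp mA.
pose cell (i : 'I_2) : set T := if i == ord0 then A else ~` A.
have mcell i : measurable (cell i) by rewrite /cell; case: ifP => // _;
  exact: measurableC.
have tcell : trivIset setT cell.
  move=> i j _ _ [t []]; rewrite /cell.
  case: eqP => [->|/eqP i0]; case: eqP => [->|/eqP j0]//= _ _.
  by apply/val_inj; move: i j i0 j0 => [[|[|//]] ?] [[|[|//]] ?].
have Ucell : \bigcup_i cell i = setT.
  apply/seteqP; split=> // t _; have [At|At] := pselect (A t).
    by exists ord0.
  by exists ord_max.
have [d' [W [P [Z [indZ lawZ law]]]]] := dp 2%N cell mcell tcell Ucell.
have ij : (ord0 : 'I_2) != ord_max by [].
have finA (p : probability T R) B : measurable B -> p B \is a fin_num.
  by move=> mB; exact: fin_num_measure.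
have par_ge0 i : (0 <= a * fine (Q (cell i)))%R by apply: mulr_ge0;
  [exact: ltW|exact: fine_ge0].
have sumpar : (a * fine (Q (cell ord0)) + a * fine (Q (cell ord_max)) = a)%R.
  rewrite -mulrDr -fineD ?finA// -measureU//.
  - by rewrite /cell/= setUv probability_setT mulr1.
  - by rewrite /cell/= setICr.
have := gamma_ratio_mean indZ lawZ par_ge0 ij; rewrite sumpar => /(_ a0).
rewrite [X in (X / _)%:E]mulrC mulfK ?gt_eqF// fineK ?finA// {1}/cell eqxx =>
  <-.
have mX : measurable_fun setT (fun p : pprobability T R => fine (p A)).
  by apply: measurableT_comp => //; exact: measurable_evaluation.
have mY : measurable_fun setT (fun w => Z ord0 w / (Z ord0 w + Z ord_max w))%R.
  apply: measurable_funM => //; apply: (measurableT_comp (@measurable_invr R)).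
  exact: measurable_funD.
pose X : {mfun pprobability T R >-> R} :=
  HB.pack (fun p : pprobability T R => fine (p A))
  (isMeasurableFun.Build _ _ _ _ _ mX).
pose Y : {mfun W >-> R} :=
  HB.pack (fun w => Z ord0 w / (Z ord0 w + Z ord_max w))%R
  (isMeasurableFun.Build _ _ _ _ _ mY).
have mnorm : measurable_fun setT (fun x : R => `|x|%:E).
  exact/measurable_EFinP.
transitivity (\int[distribution P Y]_x `|x|%:E); last first.
  by rewrite ge0_integral_distribution.
transitivity (\int[distribution pi X]_x `|x|%:E).
  rewrite ge0_integral_distribution//.
  apply: eq_integral => p _; rewrite /= ger0_norm ?fine_ge0// fineK//.
  exact: finA.
apply: eq_measure_integral => B mB _.
have mtB : measurable ((fun t : 2.-tuple R => tnth t ord0) @^-1` B).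
  rewrite -[X in measurable X]setTI; exact: measurable_tnth.
have := law _ mtB; rewrite /distribution /pushforward/=.
set S1 := (X in pi X = _); set S2 := (X in _ = P X -> _) => lawE.
transitivity (pi S1).
  by congr (pi _); apply/seteqP; split=> p; rewrite /S1/= tnth_mktuple.
rewrite lawE; congr (P _); apply/seteqP.
by split=> w; rewrite /S2/= tnth_mktuple big_ord_recl big_ord1;
  rewrite (_ : lift ord0 ord0 = ord_max)//; exact/val_inj.
Qed.

Let kpi := kprobability (measurable_cst (pi : pprobability _ R) : measurable_fun
  [set: unit] _).
Let keval := kprobability
  (measurable_snd : measurable_fun setT (snd : unit * pprobability T R -> _)).

Lemma measurable_integral_evaluation (g : T -> \bar R) : (forall t, 0 <= g t) ->
  measurable_fun setT g ->
  measurable_fun setT (fun p : pprobability T R => \int[p]_t g t).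
Proof.
move=> g0 mg.
exact: (measurable_fun_integral_kernel (measurable_kernel
  (kprobability (@measurable_id _ (pprobability T R) setT)))).
Qed.

(** The left-hand side is the integral of [g] for the composition of [pi] with
    the tautological kernel [p |-> p], and that composition is [Q]. *)
Lemma ge0_integral_mean_measure (Q : probability T R) (g : T -> \bar R) :
  (forall A, measurable A -> \int[pi]_p p A = Q A) ->
  (forall t, 0 <= g t) -> measurable_fun setT g ->
  \int[pi]_p (\int[p]_t g t) = \int[Q]_t g t.
Proof.
move=> meanQ g0 mg.
have <- : \int[kcomp kpi keval tt]_t g t = \int[Q]_t g t.
  by apply: eq_measure_integral => A mA _; exact: meanQ.
by rewrite (@integral_kcomp _ _ _ _ _ _ R kpi keval tt g g0 mg).
Qed.

(** Since [Q] is carried by [B], so is [pi]-almost every [p], and for such [p]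
    the integrals of [f] and of [shift_on B f M] differ by the constant [M]. *)
Lemma integral_mean_measure (Q : probability T R) (B : set T) (f : T -> R)
    (M : R) :
  (forall A, measurable A -> \int[pi]_p p A = Q A) ->
  measurable B -> Q B = 1 -> measurable_fun setT f ->
  (forall t, B t -> (`|f t| <= M)%R) ->
  \int[pi]_p (\int[p]_t (f t)%:E) = \int[Q]_t (f t)%:E.
Proof.
move=> meanQ mB QB mf fM.
pose g := shift_on B f M.
have Eg0 t : 0 <= (g t)%:E by rewrite lee_fin shift_on_ge0.
have mEg : measurable_fun setT (fun t => (g t)%:E).
  by apply/measurable_EFinP; exact: measurable_shift_on.
have intg := @integral_shift_on_le _ _ _ _ _ _ mB mf fM.
have finint := @integral_shift_on _ _ _ _ _ _ mB mf fM.
have aeB : {ae pi, forall p : pprobability T R, p B = 1}.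
  have : \int[pi]_p p (~` B) = 0.
    by rewrite meanQ ?probability_setC ?QB ?subee//; exact: measurableC.
  have mCB := measurable_evaluation (measurableC mB).
  move=> I0; have : ae_eq pi setT (fun p : pprobability T R => p (~` B))
    (cst 0).
    by apply/(ae_eq_integral_abs _ _ mCB) => //; rewrite -[RHS]I0;
      apply: eq_integral => p _;
      rewrite gee0_abs.
  apply: filterS => p /(_ Logic.I); rewrite /= probability_setC// => pB.
  have : p B \is a fin_num by exact: fin_num_measure.
  by move: pB; case: (p B) => [r| |]//= [/eqP]; rewrite subr_eq0 => /eqP <-.
have mint : measurable_fun setT
  (fun p : pprobability T R => \int[p]_t (g t)%:E).
  exact: measurable_integral_evaluation.
have mintf : measurable_fun setT
  (fun p : pprobability T R => \int[p]_t (f t)%:E).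
  have mEf : measurable_fun setT (fun t => (f t)%:E) by exact/measurable_EFinP.
  under eq_fun do rewrite integralE.
  apply: emeasurable_funB; apply: measurable_integral_evaluation => //.
  - exact: measurable_funepos.
  - exact: measurable_funeneg.
rewrite (finint Q QB) -(ge0_integral_mean_measure meanQ)//.
rewrite (ae_eq_integral (fun p : pprobability T R =>
  \int[p]_t (g t)%:E - M%:E))//; last 2 first.
- exact: emeasurable_funB.
- by apply: filterS aeB => p pB _; exact: finint.
rewrite integralB//; last 2 first.
- apply/integrableP; split=> //;
  apply: (@le_lt_trans _ _ (\int[pi]_p (2 * `|M|)%:E)).
    apply: ge0_le_integral => //.
    + exact: measurableT_comp.
    + by move=> p _; rewrite gee0_abs ?intg//; exact: integral_ge0.
  by rewrite integral_cst//= probability_setT mule1 ltry.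
- exact: finite_measure_integrable_cst.
by rewrite integral_cst//= probability_setT mule1.
Qed.

End dirichlet_process_mean.

(** * Regularity of the objective *)

Section euclidean.
Context {R : realType} {n : nat}.
Implicit Types u v : 'rV[R]_n.

Lemma enorm_ge0 v : 0 <= enorm v. Proof. exact: sqrtr_ge0. Qed.

Lemma enorm_le_norm v : enorm v <= Num.sqrt n%:R * `|v|.
Proof.
rewrite -[X in _ * X]ger0_norm// -sqrtr_sqr -sqrtrM//.
rewrite ler_sqrt ?mulr_ge0 ?sqr_ge0// -[n in n%:R]card_ord mulr_natl
  -sumr_const.
apply: ler_sum => i _; rewrite -real_normK ?num_real// lerXn2r ?nnegrE//.
rewrite [leRHS]/Num.norm/= mx_normrE; 
exact: (le_bigmax _ (fun ij : 'I_1 * 'I_n => `|v ij.1 ij.2|) (0, i)).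
Qed.

Lemma enorm_sub_box lo hi u : box lo hi u -> enorm (u - lo) <= enorm (hi - lo).
Proof.
move=> bu; rewrite ler_sqrt ?sumr_ge0// => [|i _]; last exact: sqr_ge0.
apply: ler_sum => i _; rewrite !mxE; have /andP[lu uh] := bu i.
rewrite lerXn2r ?nnegrE ?subr_ge0 ?lerB//; exact: le_trans uh.
Qed.

Lemma continuous_measurable_rV (f : 'rV[R]_n -> R) : continuous f ->
  measurable_fun setT (f : borel_rV R n -> R).
Proof.
move=> cf; apply: (measurability _ (RGenOInfty.measurableE R)) => //.
move=> _ [_ [x ->] <-]; rewrite setTI; apply: sub_sigma_algebra.
move/continuousP : cf; apply; exact: interval_open.
Qed.

Lemma lipschitz_continuous_rV (L : R) (f : 'rV[R]_n -> R) :
  (forall u v, `|f u - f v| <= L * enorm (u - v)) -> continuous f.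
Proof.
move=> Lf u;
  apply/(@cvgrPdist_lt _ _ _ (nbhs u) (nbhs_filter u) f (f u)) => e e0.
pose K := `|L| * Num.sqrt n%:R + 1.
have K0 : 0 < K by rewrite ltr_wpDl// mulr_ge0// sqrtr_ge0.
have : \forall v \near u, `|u - v| < e / K.
  apply: (@cvgr_dist_lt _ _ _ _ _ id u (@cvg_id _ (nbhs u))).
  exact: divr_gt0.
apply: filterS => v; rewrite ltr_pdivlMr//; apply: le_lt_trans.
apply: le_trans (Lf u v) _.
apply: le_trans (ler_wpM2r (enorm_ge0 _) (ler_norm L)) _.
apply: le_trans (ler_wpM2l (normr_ge0 L) (enorm_le_norm _)) _.
have := normr_ge0 (u - v); rewrite /K.
by move: `|u - v| `|L| (Num.sqrt _) => D a b; lra.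
Qed.

Lemma measurable_box lo hi : measurable (box lo hi : set (borel_rV R n)).
Proof.
have -> : box lo hi = \bigcap_(i in [set: 'I_n])
  ((fun u : borel_rV R n => u 0 i) @^-1` `[lo 0 i, hi 0 i]).
  apply/seteqP; split=> [u bu i _|u bu i]; first by rewrite /= in_itv/= bu.
  by have := bu i Logic.I; rewrite /= in_itv.
apply: fin_bigcap_measurable => // i _.
rewrite -[X in measurable X]setTI; apply: continuous_measurable_rV => //.
exact: coord_continuous.
Qed.

End euclidean.

Section objective_lipschitz.
Context {R : realType} {n l : nat}.
Variables (X : set 'rV[R]_n) (h : 'rV[R]_n -> borel_rV R l -> R) (L1 L2 : R).
Variables (lo hi : 'rV[R]_l).
Hypothesis L1_ge0 : 0 <= L1.
Hypothesis Lip_u : forall x u1 u2, X x -> `|h x u1 - h x u2|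
  <= L1 * enorm (u1 - u2).
Hypothesis Lip_x : forall x1 x2 u, X x1 -> X x2 ->
  `|h x1 u - h x2 u| <= L2 * enorm (x1 - x2).

Definition cost_bound x := `|h x lo| + L1 * enorm (hi - lo).

Lemma cost_boundP x u : X x -> box lo hi u -> `|h x u| <= cost_bound x.
Proof.
move=> Xx bu; rewrite /cost_bound -[h x u](subrK (h x lo)) addrC.
apply: le_trans (ler_normD _ _) _; rewrite lerD2l.
apply: le_trans (Lip_u _ _ Xx) _; rewrite ler_wpM2l//.
exact: enorm_sub_box.
Qed.

Lemma measurable_cost x : X x -> measurable_fun setT (h x).
Proof.
move=> Xx; apply: continuous_measurable_rV.
by apply: (@lipschitz_continuous_rV _ _ L1) => u v; exact: Lip_u.
Qed.

Variables (P : probability (borel_rV R l) R).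
Hypothesis Pbox : P (box lo hi) = 1%E.

Lemma integrable_cost x : X x -> P.-integrable setT (EFin \o h x).
Proof.
move=> Xx; apply/integrableP; split; first by apply/measurable_EFinP;
  exact: measurable_cost.
apply: (@le_lt_trans _ _ (\int[P]_u (cost_bound x)%:E)%E).
  apply: ae_ge0_le_integral => //.
  - by apply: measurableT_comp => //; apply/measurable_EFinP;
    exact: measurable_cost.
  - move=> u _; rewrite lee_fin addr_ge0// mulr_ge0 ?enorm_ge0//.
  exists (~` box lo hi); split; first by apply: measurableC;
    exact: measurable_box.
    apply: etrans (probability_setC P (measurable_box lo hi)) _.
    by rewrite Pbox subee.
  move=> u /= nu bu; apply: nu => _; rewrite lee_fin; exact: cost_boundP.
by rewrite integral_cst//= probability_setT mule1 ltry.
Qed.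

Lemma objective_fin_num x : X x -> objective h P x \is a fin_num.
Proof. by move=> Xx; apply: integrable_fin_num => //;
  exact: integrable_cost. Qed.

Lemma objective_lipschitz x y : X x -> X y ->
  `|fine (objective h P x) - fine (objective h P y)| <= L2 * enorm (x - y).
Proof.
move=> Xx Xy.
have ix := integrable_cost Xx; have iy := integrable_cost Xy.
have ixy := integrableB measurableT ix iy.
rewrite -lee_fin -fineB ?objective_fin_num//.
rewrite -integralB_EFin// -abse_EFin fineK; last first.
  by apply: integrable_fin_num => //; exact: ixy.
apply: le_trans (le_abse_integral _ _ _) _ => //.
  by apply: measurable_int; exact: ixy.
apply: (@le_trans _ _ (\int[P]_u (L2 * enorm (x - y))%:E)%E).
  apply: ge0_le_integral => //.
  - apply: measurableT_comp => //; apply: (measurable_int P); exact: ixy.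
  - by move=> u _; rewrite -EFinB abse_EFin lee_fin; exact: Lip_x.
by rewrite integral_cst//= probability_setT mule1.
Qed.

End objective_lipschitz.

(** * Consistency *)

Section posterior_base.
Local Open Scope ereal_scope.
Context {R : realType} {d : measure_display} {T : measurableType d}.
Variables (alpha : {posnum R}) (P0 : probability T R).

Lemma ge0_integral_dp_posterior_base (s : nat) (u : nat -> T)
    (g : T -> \bar R) :
  (forall t, 0 <= g t) -> measurable_fun setT g ->
  \int[dp_posterior_base alpha P0 s u]_t g t =
  ((alpha%:num + s%:R)^-1)%:E *
    (alpha%:num%:E * \int[P0]_t g t + \sum_(j < s) g (u j)).
Proof.
move=> g0 mg; rewrite /dp_posterior_base ge0_integral_mscale//=; congr (_ * _).
rewrite ge0_integral_measure_add//; congr (_ + _).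
  by rewrite ge0_integral_mscale.
rewrite ge0_integral_measure_sum//; apply: eq_bigr => j _.
by rewrite integral_dirac//= diracT mul1e.
Qed.

Lemma dp_posterior_base_eq1 (s : nat) (u : nat -> T) (B : set T) :
  P0 B = 1 -> (forall j, B (u j)) -> dp_posterior_base alpha P0 s u B = 1.
Proof.
move=> P0B uB; rewrite dp_posterior_baseE P0B mule1.
under eq_bigr do rewrite diracE mem_set//.
by rewrite sumEFin sumr_const card_ord -EFinD -EFinM mulVf.
Qed.

End posterior_base.

(** The prior's share [alpha / (alpha + n)] of the weight vanishes. *)
Lemma cvg_prior_weighted_mean (R : realType) (a c m : R) (S : nat -> R) :
  0 < a -> S 0%N = 0 -> S n / n%:R @[n --> \oo] --> m ->
  (a + n%:R)^-1 * (a * c + S n) @[n --> \oo] --> m.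
Proof.
move=> a0 S0 cS.
have anE n : (a + n%:R)^-1 * (a * c + S n) =
    S n / n%:R + (a + n%:R)^-1 * (a * (c - S n / n%:R)).
  have an0 : a + n%:R != 0 by rewrite gt_eqF// ltr_wpDr.
  (* At [n = 0] both sides are [c], since [0 / 0 = 0]. *)
  case: n an0 => [|n] an0.
    by rewrite S0 mul0r !addr0 add0r subr0.
  have n0 : n.+1%:R != 0 :> R by [].
  by move: n.+1%:R an0 n0 => x an0 n0; field; rewrite an0 n0.
under eq_fun do rewrite anE.
suff : S n / n%:R + (a + n%:R)^-1 * (a * (c - S n / n%:R)) @[n --> \oo] -->
    m + 0 * (a * (c - m)) by rewrite mul0r addr0.
apply: cvgD => //; apply: cvgM.
  apply/gtr0_cvgV0; first by apply: nearW => n; rewrite ltr_wpDr.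
  apply: (@cvg_comp _ _ _ (fun n => n%:R) (fun r => a + r) _ (pinfty_nbhs R)).
    exact: cvgr_idn.
  exact: cvg_addrl.
by apply: cvgM; [exact: cvg_cst|apply: cvgB => //; exact: cvg_cst].
Qed.

Section consistency.
Context {R : realType} {n l : nat}.
Variables (X : set 'rV[R]_n) (h : 'rV[R]_n -> borel_rV R l -> R) (L1 L2 : R).
Variables (lo hi : 'rV[R]_l).
Hypothesis L1_ge0 : 0 <= L1.
Hypothesis Lip_u : forall x u1 u2, X x -> `|h x u1 - h x u2|
  <= L1 * enorm (u1 - u2).
Variables (Pc P0 : probability (borel_rV R l) R) (alpha : {posnum R}).
Hypotheses (Pcbox : Pc (box lo hi) = 1%E) (P0box : P0 (box lo hi) = 1%E).

Let M x := cost_bound h L1 lo hi x.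
Let g x := shift_on (box lo hi : set (borel_rV R l)) (h x) (M x).

Let mbox : measurable (box lo hi : set (borel_rV R l)) := measurable_box lo hi.
Let hM x : X x -> forall u, box lo hi u -> `|h x u| <= M x.
Proof. by move=> Xx u bu; apply: (cost_boundP L1_ge0 Lip_u). Qed.
Let mh x : X x -> measurable_fun setT (h x).
Proof. by move=> Xx; exact: (measurable_cost Lip_u). Qed.

(** A Dirichlet process has its base distribution as mean measure, so that
    averaging the expected cost over the posterior is the same as taking the
    expected cost under the posterior base distribution. *)
Lemma bayes_objectiveE (s : nat) (u : nat -> borel_rV R l)
    (pi : probability (pprobability (borel_rV R l) R) R) x : X x ->
  (forall j, box lo hi (u j)) ->
  is_dirichlet_process (alpha%:num + s%:R) (dp_posterior_base alpha P0 s u) pi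
    ->
  bayes_objective h pi x = objective h (dp_posterior_base alpha P0 s u) x.
Proof.
move=> Xx ubox dp; apply: (integral_mean_measure _ mbox _ (mh Xx) (hM Xx)).
  by move=> A mA; apply: (dirichlet_process_mean _ dp mA); rewrite ltr_wpDr.
exact: dp_posterior_base_eq1.
Qed.

Lemma objective_dp_posterior_base_cvg (u : nat -> borel_rV R l) x : X x ->
  (forall j, box lo hi (u j)) ->
  (\sum_(j < s) g x (u j)) / s%:R @[s --> \oo] -->
    fine (\int[Pc]_t (g x t)%:E)%E ->
  objective h (dp_posterior_base alpha P0 s u) x @[s --> \oo] -->
    objective h Pc x.
Proof.
move=> Xx ubox mean_cvg.
have intfin (p : probability (borel_rV R l) R) : (\int[p]_t (g x t)%:E)%E \is a
  fin_num.
  rewrite ge0_fin_numE; last first.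
    by apply: integral_ge0 => t _; rewrite lee_fin; apply: shift_on_ge0;
      exact: hM.
  by apply: le_lt_trans (integral_shift_on_le mbox (mh Xx) (hM Xx) p) (ltry _).
have objE (p : probability (borel_rV R l) R) : p (box lo hi) = 1%E ->
    objective h p x = (fine (\int[p]_t (g x t)%:E)%E - M x)%:E.
  move=> pbox; rewrite EFinB fineK//.
  exact: (integral_shift_on mbox (mh Xx) (hM Xx)).
rewrite (objE _ Pcbox).
have -> : (fun s => objective h (dp_posterior_base alpha P0 s u) x) = (fun s =>
    ((alpha%:num + s%:R)^-1 * (alpha%:num * fine (\int[P0]_t (g x t)%:E)%E +
      \sum_(j < s) g x (u j)) - M x)%:E).
  apply/funext => s; rewrite objE; last exact: dp_posterior_base_eq1.
  rewrite ge0_integral_dp_posterior_base; last 2 first.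
  - by move=> t; rewrite lee_fin; apply: shift_on_ge0; exact: hM.
  - by apply/measurable_EFinP; apply: measurable_shift_on => //; exact: mh.
  by rewrite -[in X in fine X](fineK (intfin P0)) sumEFin.
apply/fine_cvgP; split; first exact: nearW.
rewrite /comp/=.
apply: cvgB; last exact: cvg_cst.
apply: (@cvg_prior_weighted_mean _ _ _ _ (fun s => \sum_(j < s) g x (u j))) =>
  //.
by rewrite big_ord0.
Qed.

Context {disp : measure_display} {W : measurableType disp}
  (Pr : probability W R).
Variable (U : nat -> {RV Pr >-> borel_rV R l}).
Hypothesis iidU : iid U Pc.

Lemma ae_in_box : {ae Pr, forall w, forall j, box lo hi (U j w)}.
Proof.
apply: ae_foralln => j; exists (U j @^-1` ~` box lo hi); split => //.
- by apply: measurable_funPTI; exact: measurableC.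
- rewrite -[LHS]/(distribution Pr (U j) _) iidU.2; last exact: measurableC.
  by apply: etrans (probability_setC Pc mbox) _; rewrite Pcbox subee.
Qed.

Lemma ae_objective_dp_posterior_base_cvg x : X x -> {ae Pr, forall w,
  objective h (dp_posterior_base alpha P0 s (fun j => U j w)) x @[s --> \oo] -->
  objective h Pc x}.
Proof.
move=> Xx; have mg : measurable_fun setT (g x).
  by apply: measurable_shift_on => //; exact: mh.
have g0 t : 0 <= g x t by apply: shift_on_ge0; exact: hM.
have gB t : g x t <= 2 * `|M x| by apply: shift_on_le; exact: hM.
apply: filterS2 ae_in_box (bounded_slln iidU mg g0 gB) => w ubox.
exact: objective_dp_posterior_base_cvg.
Qed.

End consistency.

Theorem theorem1 (R : realType) (d l : nat)
    (X : set 'rV[R]_d) (h : 'rV[R]_d -> borel_rV R l -> R)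
    (L1 L2 L3 : R) (lo hi : 'rV[R]_l)
    (Pc P0 : probability (borel_rV R l) R) (alpha : {posnum R})
    (disp : measure_display) (W : measurableType disp) (Pr : probability W R)
    (U : nat -> {RV Pr >-> borel_rV R l})
    (pi : nat -> W -> probability (pprobability (borel_rV R l) R) R)
    (xstar : 'rV[R]_d) (xs : nat -> W -> 'rV[R]_d) :
  compact X ->
  0 < L1 -> 0 < L2 -> 0 < L3 ->
  (forall x u, X x -> differentiable (h ^~ u : 'rV[R]_d -> R^o) x) ->
  (forall x u1 u2, X x -> `|h x u1 - h x u2| <= L1 * enorm (u1 - u2)) ->
  (forall x1 x2 u, X x1 -> X x2 -> `|h x1 u - h x2 u| <= L2 * enorm (x1 - x2)) ->
  (forall x1 x2 u, X x1 -> X x2 ->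
     enorm (gradient (h ^~ u) x1 - gradient (h ^~ u) x2) <= L3 * enorm (x1 - x2)) ->
  Pc (box lo hi) = 1%E ->
  P0 (box lo hi) = 1%E ->
  iid U Pc ->
  (forall s w, is_dirichlet_process (alpha%:num + s%:R)
     (dp_posterior_base alpha P0 s (fun j => U j w)) (pi s w)) ->
  argmin X (objective h Pc) = [set xstar] ->
  (forall s w, argmin X (bayes_objective h (pi s w)) (xs s w)) ->
  [/\ forall x, X x ->
        {ae Pr, forall w,
          bayes_objective h (pi s w) x @[s --> \oo] --> objective h Pc x},
      {ae Pr, forall w, xs s w @[s --> \oo] --> xstar}
    & {ae Pr, forall w,
        bayes_objective h (pi s w) (xs s w) @[s --> \oo] -->
          objective h Pc xstar}].
Proof.
move=> cX L1_gt0 L2_gt0 _ _ Lip_u Lip_x _ Pcbox P0box iidU dp argminF argminFs.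
have L1_ge0 := ltW L1_gt0.
have [Xxstar minF] : argmin X (objective h Pc) xstar by rewrite argminF.
have in_box := ae_in_box Pcbox iidU.
pose Q s w := dp_posterior_base alpha P0 s (fun j => U j w).
have bayesE w : (forall j, box lo hi (U j w)) -> forall s x, X x ->
    bayes_objective h (pi s w) x = objective h (Q s w) x.
  by move=> ubox s x Xx; exact: (bayes_objectiveE L1_ge0 Lip_u P0box Xx ubox).
have cvgQ x : X x -> {ae Pr, forall w,
    objective h (Q s w) x @[s --> \oo] --> objective h Pc x}.
  exact: (ae_objective_dp_posterior_base_cvg L1_ge0 Lip_u alpha Pcbox P0box
    iidU).
(* One null set has to serve all decisions at once: the strong law is used along
   the dense sequence [D], and the Lipschitz bound extends it to [X]. *)
have [D [XD dD]] := compact_dense_sequence cX (ex_intro _ xstar Xxstar).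
(* The hypotheses use the Euclidean norm, the topology the sup norm. *)
pose K := L2 * (Num.sqrt d%:R + 1).
have K0 : 0 < K by rewrite mulr_gt0// ltr_wpDl// sqrtr_ge0.
have Lip_obj (P : probability (borel_rV R l) R) x y : P (box lo hi) = 1%E ->
    X x -> X y ->
    `|fine (objective h P x) - fine (objective h P y)| <= K * `|x - y|.
  move=> Pbox Xx Xy.
  apply: (le_trans (objective_lipschitz L1_ge0 Lip_u Lip_x Pbox Xx Xy)).
  rewrite /K -mulrA (ler_wpM2l (ltW L2_gt0))//;
    apply: le_trans (enorm_le_norm _) _.
  by rewrite mulrDl mul1r lerDl.
have Qbox s w : (forall j, box lo hi (U j w)) -> Q s w (box lo hi) = 1%E.
  exact: dp_posterior_base_eq1.
have finQ s w : (forall j, box lo hi (U j w)) -> forall x, X x ->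
    objective h (Q s w) x \is a fin_num.
  by move=> ubox x Xx; exact: (objective_fin_num L1_ge0 Lip_u (Qbox s w ubox)).
have solution : {ae Pr, forall w, xs s w @[s --> \oo] --> xstar /\
    bayes_objective h (pi s w) (xs s w) @[s --> \oo] --> objective h Pc xstar}.
  have := ae_foralln (fun k => cvgQ (D k) (XD k)).
  apply: filterS2 in_box => w ubox cvgD.
  pose F x := fine (objective h Pc x).
  pose Fs s x := fine (objective h (Q s w) x).
  have FE x : X x -> objective h Pc x = (F x)%:E.
    by move=> Xx; rewrite fineK//;
      exact: (objective_fin_num L1_ge0 Lip_u Pcbox).
  have FsE s x : X x -> objective h (Q s w) x = (Fs s x)%:E.
    by move=> Xx; rewrite fineK//; exact: finQ.
  have Xxs s : X (xs s w) by case: (argminFs s w).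
  have minF' x : X x -> x != xstar -> F xstar < F x.
    move=> Xx xxstar; rewrite ltNge; apply/negP => Fx.
    suff : argmin X (objective h Pc) x by rewrite argminF => /eqP;
      rewrite (negbTE xxstar).
    split=> // y Xy; apply: le_trans (minF y Xy).
    by rewrite !FE// lee_fin.
  have minFs s x : X x -> Fs s (xs s w) <= Fs s x.
    move=> Xx; rewrite -lee_fin -!FsE// -!bayesE//.
    by case: (argminFs s w) => _; exact.
  have cvgF x : X x -> Fs s x @[s --> \oo] --> F x.
    apply: (lipschitz_cvg_dense K0 XD dD (Fs := Fs) (F := F)).
    - by move=> s y z Xy Xz; apply: Lip_obj => //; exact: Qbox.
    - by move=> y z Xy Xz; exact: Lip_obj.
    - by move=> k; move: (cvgD k); rewrite FE// => /fine_cvgP[].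
  have [cxs cval] := argmin_consistency K0 cX
    (fun s x y Xx Xy => Lip_obj (Q s w) x y (Qbox s w ubox) Xx Xy) cvgF Xxstar
      minF' Xxs minFs.
  split=> //; rewrite FE//.
  under eq_fun do rewrite bayesE// FsE//.
  by apply/fine_cvgP; split; first exact: nearW.
split.
- move=> x Xx; apply: filterS2 in_box (cvgQ x Xx) => w ubox.
  by under eq_fun do rewrite -(bayesE w ubox _ x Xx).
- by apply: filterS solution => w [].
- by apply: filterS solution => w [].
Qed.
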